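(* For each $k=1,\dots,N$ let the joint-smoothed distribution under the current parameters $\theta'$ be the Gaussian mixture $$p_{\theta'}(x_{k+1},z_{k+1},x_k,z_k\mid y_{1:N})=\sum_{j=1}^{M^{\mathrm S}_k}w^j_{k:k+1|N}(z_k,z_{k+1})\,\mathcal N\left(\begin{bmatrix} x_k \\ x_{k+1} \end{bmatrix}\Big|\ \mu^j_{k:k+1|N}(z_k,z_{k+1}),\mathbf P^j_{k:k+1|N}(z_k,z_{k+1})\right).$$ For $z\in\{1,\dots,m\}$ put $c_m(z)=\sum_{k=1}^N\sum_{j=1}^m\sum_{\ell=1}^{M^{\mathrm S}_k}w^\ell_{k:k+1|N}(z,j)$ and $$\mathbf M^{1/2}(z)=\left(\sum_{k=1}^N\sum_{j=1}^m\sum_{\ell=1}^{M^{\mathrm S}_k}w^\ell_{k:k+1|N}(z,j)\,\mathbb E_k^{z,j,\ell}\left[\begin{bmatrix} X_k \\ X_{k+1} \\ u_k \\ y_k \end{bmatrix}\begin{bmatrix} X_k \\ X_{k+1} \\ u_k \\ y_k \end{bmatrix}^T\right]\right)^{1/2}.$$ Then a parameter set maximising $\theta\mapsto\mathcal Q(\theta,\theta')$ is obtained as follows. Set $$\boldsymbol\Sigma(z)=T_1(\mathbf M^{1/2}(z))^T\mathbf M^{1/2}(z)T_1^T,\quad \boldsymbol\Phi(z)=T_2(\mathbf M^{1/2}(z))^T\mathbf M^{1/2}(z)T_2^T,\quad \boldsymbol\Psi(z)=T_2(\mathbf M^{1/2}(z))^T\mathbf M^{1/2}(z)T_1^T,$$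 $$T_1=\begin{bmatrix}\mathbf I_{n_x}&\mathbf 0&\mathbf 0&\mathbf 0 \\ \mathbf 0&\mathbf 0&\mathbf I_{n_u}&\mathbf 0\end{bmatrix},\qquad T_2=\begin{bmatrix}\mathbf 0&\mathbf 0&\mathbf 0&\mathbf I_{n_y} \\ \mathbf 0&\mathbf I_{n_x}&\mathbf 0&\mathbf 0\end{bmatrix}$$ (block columns of widths $n_x,n_x,n_u,n_y$). Then $p(x_1,z_1)=p_{\theta'}(x_1,z_1\mid y_{1:N})$, $$\begin{bmatrix}\mathbf C(z)&\mathbf D(z) \\ \mathbf A(z)&\mathbf B(z)\end{bmatrix}=\boldsymbol\Gamma(z)=\boldsymbol\Psi(z)\boldsymbol\Sigma^{-1}(z),\qquad \mathbf T(z^*,z)=\frac{\sum_{k=1}^N\sum_{j=1}^{M^{\mathrm S}_k}w^j_{k:k+1|N}(z,z^* )}{c_m(z)},$$ and a square-root factor of the optimal covariance $\boldsymbol\Pi(z)$ is $$\boldsymbol\Pi^{1/2}(z)=\frac1{\sqrt{c_m(z)}}\,\mathbf M^{1/2}(z)\begin{bmatrix}-\mathbf C^T(z)&-\mathbf A^T(z) \\ \mathbf 0_{n_x\times n_y}&\mathbf I_{n_x} \\ -\mathbf D^T(z)&-\mathbf B^T(z) \\ \mathbf I_{n_y}&\mathbf 0_{n_y\times n_x}\end{bmatrix}$$ (which is brought to upper triangular form by a QR decomposition). Moreover, a square-root factor $C=(w_aA^TA+w_bB^TB+\cdots)^{1/2}$ of a nonnegatively weighted sum, as needed for $\mathbf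 M^{1/2}(z)$, is given by the Q-less QR decomposition $$C=\boldsymbol{\mathcal Q}\begin{bmatrix}\sqrt{w_a}A \\ \sqrt{w_b}B \\ \vdots\end{bmatrix}.$$
   Context: Jump Markov linear system with modes $Z_k\in\{1,\dots,m\}$, states $X_k\in\mathbb R^{n_x}$, known inputs $u_k\in\mathbb R^{n_u}$ and observations $y_k\in\mathbb R^{n_y}$: $$X_{k+1}=\mathbf A(Z_k)X_k+\mathbf B(Z_k)u_k+V_k,\quad Y_k=\mathbf C(Z_k)X_k+\mathbf D(Z_k)u_k+E_k,$$ where, given $Z_k$, $(V_k,E_k)$ is zero-mean Gaussian white noise with $\mathrm{Cov}(V_k)=\mathbf Q(Z_k)$, $\mathrm{Cov}(E_k)=\mathbf R(Z_k)$, $\mathrm{Cov}(V_k,E_k)=\mathbf S(Z_k)$, and $Z_k$ is a Markov chain with $\mathbf T(j,i)=\mathbb P(Z_{k+1}=j\mid Z_k=i)$. Write $$\boldsymbol\Gamma(z)=\begin{bmatrix}\mathbf C(z)&\mathbf D(z) \\ \mathbf A(z)&\mathbf B(z)\end{bmatrix},\qquad \boldsymbol\Pi(z)=\begin{bmatrix}\mathbf R(z)&\mathbf S^T(z) \\ \mathbf S(z)&\mathbf Q(z)\end{bmatrix}.$$ The parameter $\theta$ comprises a density $p_\theta(x_1,z_1)$, the matrix $\mathbf T$ with nonnegative entries, arbitrary real matrices $\boldsymbol\Gamma(z)$, and symmetric positive definite $\boldsymbol\Pi(z)$. With data $y_{1:N},u_{1:N}$ fixed, the $\mathcal Q$-function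 is $$\mathcal Q(\theta,\theta')=\sum_{z_{1:N+1}}\int\ln\big(p_\theta(x_{1:N+1},z_{1:N+1},y_{1:N})\big)\,p_{\theta'}(x_{1:N+1},z_{1:N+1}\mid y_{1:N})\,dx_{1:N+1},$$ where $$\ln p_\theta(x_{1:N+1},z_{1:N+1},y_{1:N})=\ln p_\theta(x_1,z_1)+\sum_{k=1}^N\left[\ln\mathcal N\left(\begin{bmatrix} y_k \\ x_{k+1} \end{bmatrix}\Big|\ \boldsymbol\Gamma(z_k)\begin{bmatrix} x_k \\ u_k \end{bmatrix},\boldsymbol\Pi(z_k)\right)+\ln\frac{\mathbf T(z_{k+1},z_k)}{\sum_{\ell=1}^m\mathbf T(\ell,z_k)}\right].$$ $\mathcal N(\cdot\mid\mu,\mathbf P)$ is the Gaussian density with mean $\mu$ and covariance $\mathbf P$. The joint-smoothed densities in the claim are the marginals of $p_{\theta'}(x_{1:N+1},z_{1:N+1}\mid y_{1:N})$. $\mathbb E_k^{z,j,\ell}[f(X_k,X_{k+1})]$ denotes the expectation of $f$ when $(X_k,X_{k+1})$ is Gaussian with mean $\mu^\ell_{k:k+1|N}(z,j)$ and covariance $\mathbf P^\ell_{k:k+1|N}(z,j)$; $u_k$ and $y_k$ are fixed known values. A square-root factor $A^{1/2}$ of a symmetric positive semidefinite matrix $A$ is a matrix with $(A^{1/2})^TA^{1/2}=A$. In a Q-less QR decomposition $\boldsymbol{\mathcal Q}X$, $\boldsymbol{\mathcal Q}$ is orthogonal and such that the product is upper triangular. The formulas are understood in the case where they are well defined, i.e.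 $c_m(z)>0$, $\boldsymbol\Sigma(z)$ is invertible and the resulting $\boldsymbol\Pi(z)$ is positive definite. *)

(* Defs.v *)
From HB Require Import structures.
From mathcomp Require Import all_boot all_order all_algebra.
From mathcomp Require Import all_classical all_reals all_analysis.

Set Implicit Arguments.
Unset Strict Implicit.
Unset Printing Implicit Defensive.
Import Order.TTheory GRing.Theory Num.Theory.
Import numFieldNormedType.Exports.
Local Open Scope classical_set_scope.
Local Open Scope ring_scope.

(* The library has product measures on pairs only. tuple_measure mu n is the
   n-fold power of a sigma-finite measure mu, as a measure on n.-tuple T. *)
Section tuple_measure.
Context d (T : measurableType d) (R : realType).
Variable mu : {sigma_finite_measure set T -> \bar R}.

Definition consT n (p : T * n.-tuple T) : n.+1.-tuple T :=
  [tuple of p.1 :: p.2].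

Lemma measurable_consT n : measurable_fun [set: T * n.-tuple T] (@consT n).
Proof. exact: measurable_cons. Qed.

HB.instance Definition _ n :=
  isMeasurableFun.Build _ _ _ _ (@consT n) (@measurable_consT n).

Section cons_measure.
Context n (nu : {sigma_finite_measure set (n.-tuple T) -> \bar R}).

Definition cons_measure : set (n.+1.-tuple T) -> \bar R :=
  pushforward (mu \x nu)%E (@consT n).

Let cons_measure0 : cons_measure set0 = 0%E.
Proof. exact: measure0. Qed.

Let cons_measure_ge0 A : (0 <= cons_measure A)%E.
Proof. exact: measure_ge0. Qed.

Let cons_measure_sigma_additive : semi_sigma_additive cons_measure.
Proof. exact: measure_semi_sigma_additive. Qed.

HB.instance Definition _ := isMeasure.Build _ _ _ cons_measure
  cons_measure0 cons_measure_ge0 cons_measure_sigma_additive.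

Let cons_measure_sigma_finite : sigma_finite setT cons_measure.
Proof.
have /sigma_finiteP[F [TF ndF Foo]] := sigma_finiteT mu.
have /sigma_finiteP[G [TG ndG Goo]] := sigma_finiteT nu.
exists (fun k => [set t | F k (thead t) /\ G k [tuple of behead t]]).
  apply/seteqP; split=> // t _.
  have [i _ Fi] : (\bigcup_i F i) (thead t) by rewrite -TF.
  have [j _ Gj] : (\bigcup_i G i) [tuple of behead t] by rewrite -TG.
  exists (maxn i j) => //; split.
    by move: Fi; apply/subsetPset/ndF/leq_maxl.
  by move: Gj; apply/subsetPset/ndG/leq_maxr.
move=> k; have [mF Fk] := Foo k; have [mG Gk] := Goo k; split.
  apply: measurableI; rewrite -[X in measurable X]setTI.
    exact: (@measurable_tnth _ T n.+1 ord0).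
  exact: measurable_behead.
rewrite /cons_measure /pushforward.
have -> : @consT n @^-1` [set t | F k (thead t) /\ G k [tuple of behead t]] =
    F k `*` G k.
  have beheadE x (t : n.-tuple T) :
      [tuple of behead (@consT n (x, t))] = t :> n.-tuple T by exact: val_inj.
  by apply/seteqP; split=> -[x t]; rewrite /= theadE beheadE.
by rewrite product_measure1E// lte_mul_pinfty// ge0_fin_numE.
Qed.

HB.instance Definition _ :=
  Measure_isSigmaFinite.Build _ _ _ cons_measure cons_measure_sigma_finite.

End cons_measure.

Fixpoint tuple_measure n : {sigma_finite_measure set (n.-tuple T) -> \bar R} :=
  match n with
  | 0 => dirac ([tuple] : 0.-tuple T)
  | n'.+1 => cons_measure (tuple_measure n')
  end.

End tuple_measure.

Section vectors_and_matrices.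
Context {R : realType}.

Definition pos_def n (P : 'M[R]_n) : Prop :=
  P^T = P /\ forall v : 'cV[R]_n, v != 0 -> 0 < (v^T *m P *m v) 0 0.

(* The factor need not be square. *)
Definition is_sqrt_factor r n (C : 'M[R]_(r, n)) (A : 'M[R]_n) : Prop :=
  C^T *m C = A.

Definition upper_triangular r n (X : 'M[R]_(r, n)) : Prop :=
  forall (i : 'I_r) (j : 'I_n), (j < i)%N -> X i j = 0.

Definition is_qless_QR r n (O : 'M[R]_r) (X : 'M[R]_(r, n)) : Prop :=
  O^T *m O = 1%:M /\ upper_triangular (O *m X).

Definition gauss_pdf n (mu : 'cV[R]_n) (P : 'M[R]_n) (x : 'cV[R]_n) : R :=
  (Num.sqrt ((2 * pi) ^+ n * \det P))^-1 *
  expR (- ((x - mu)^T *m invmx P *m (x - mu)) 0 0 / 2).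

Definition vec n (x : n.-tuple (measurableTypeR R)) : 'cV[R]_n :=
  \col_i tnth x i.


(* Lebesgue measure on $R^n$. *)
Definition leb n :
    {sigma_finite_measure set (n.-tuple (measurableTypeR R)) -> \bar R} :=
  tuple_measure (@lebesgue_measure R) n.

End vectors_and_matrices.

Section jump_markov_linear_system.
Context {R : realType}.
Variables (m nx nu ny N : nat).

Let state := nx.-tuple (measurableTypeR R).
Let traj n := n.-tuple state.
Let modes := N.+1.-tuple 'I_m.

Definition leb_traj n : {sigma_finite_measure set (traj n) -> \bar R} :=
  tuple_measure (leb nx) n.

Definition leb_pair : {measure set (state * state) -> \bar R} :=
  (leb nx \x leb nx)%E.

(* Gam = [C D; A B] and Pi = [R S^T; S Q]: the rows are indexed by (y_k, x_{k+1}).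
   init_pdf is a density with respect to Lebesgue times counting measure. *)
Record param := Param {
  init_pdf : state -> 'I_m -> R ;
  Tmat : 'M[R]_m ;
  Gam : 'I_m -> 'M[R]_(ny + nx, nx + nu) ;
  Pi : 'I_m -> 'M[R]_(ny + nx) }.

Definition is_param (th : param) : Prop :=
  [/\ [/\ forall z, measurable_fun [set: state] (init_pdf th ^~ z),
          forall x z, 0 <= init_pdf th x z &
          (\sum_(z < m) \int[leb nx]_x (init_pdf th x z)%:E = 1)%E],
      forall j i, 0 <= Tmat th j i &
      forall z, pos_def (Pi th z)].

Definition Cmat (G : 'M[R]_(ny + nx, nx + nu)) : 'M[R]_(ny, nx) := ulsubmx G.
Definition Dmat (G : 'M[R]_(ny + nx, nx + nu)) : 'M[R]_(ny, nu) := ursubmx G.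
Definition Amat (G : 'M[R]_(ny + nx, nx + nu)) : 'M[R]_nx := dlsubmx G.
Definition Bmat (G : 'M[R]_(ny + nx, nx + nu)) : 'M[R]_(nx, nu) := drsubmx G.

(* Times 1..N are 'I_N and times 1..N+1 are 'I_N.+1, both counted from 0. *)
Definition now (k : 'I_N) : 'I_N.+1 := widen_ord (leqnSn N) k.
Definition next (k : 'I_N) : 'I_N.+1 := lift ord0 k.

Section data.
Variables (u : 'I_N -> 'cV[R]_nu) (y : 'I_N -> 'cV[R]_ny).

Definition gauss_factor (th : param) (x : traj N.+1) (z : modes) (k : 'I_N) : R :=
  gauss_pdf (Gam th (tnth z (now k)) *m col_mx (vec (tnth x (now k))) (u k))
    (Pi th (tnth z (now k))) (col_mx (y k) (vec (tnth x (next k)))).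

(* Tmat j i is proportional to P(Z_{k+1} = j | Z_k = i); a zero column gives
   transition probabilities 0 / 0 = 0. *)
Definition trans_prob (th : param) (j i : 'I_m) : R :=
  Tmat th j i / \sum_(l < m) Tmat th l i.

(* p_th(x_{1:N+1}, z_{1:N+1}, y_{1:N}) as a function of the trajectory (x, z);
   lne_joint_pdf below gives its logarithm as a sum. *)
Definition joint_pdf (th : param) (x : traj N.+1) (z : modes) : R :=
  init_pdf th (tnth x ord0) (tnth z ord0) *
  \prod_(k < N)
    (gauss_factor th x z k * trans_prob th (tnth z (next k)) (tnth z (now k))).

Lemma lne_joint_pdf (th : param) (x : traj N.+1) (z : modes) : is_param th ->
  lne (joint_pdf th x z)%:E =
  (lne (init_pdf th (tnth x ord0) (tnth z ord0))%:E +
   \sum_(k < N)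
     (lne (gauss_factor th x z k)%:E +
      lne (trans_prob th (tnth z (next k)) (tnth z (now k)))%:E))%E.
Proof.
have lneMr (a b : R) : 0 <= a -> 0 <= b ->
    lne (a * b)%:E = (lne a%:E + lne b%:E)%E.
  rewrite le_eqVlt => /predU1P[<- _|a0].
    by rewrite mul0r [lne 0%:E]le0_lneNy// addNye.
  rewrite le_eqVlt => /predU1P[<-|b0].
    by rewrite mulr0 [lne 0%:E]le0_lneNy// addeNy.
  by rewrite !lne_EFin ?mulr_gt0// lnM ?posrE// EFinD.
case=> -[_ p0 _] T0 _.
have g0 k : 0 <= gauss_factor th x z k.
  by rewrite mulr_ge0 ?invr_ge0 ?sqrtr_ge0 ?expR_ge0.
have t0 j i : 0 <= trans_prob th j i by rewrite mulr_ge0 ?invr_ge0 ?sumr_ge0.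
rewrite lneMr ?prodr_ge0//; last by move=> k _; rewrite mulr_ge0.
congr (_ + _)%E.
suff [] : 0 <= \prod_(k < N) (gauss_factor th x z k *
      trans_prob th (tnth z (next k)) (tnth z (now k))) /\
    lne (\prod_(k < N) (gauss_factor th x z k *
      trans_prob th (tnth z (next k)) (tnth z (now k))))%:E =
    (\sum_(k < N) (lne (gauss_factor th x z k)%:E +
      lne (trans_prob th (tnth z (next k)) (tnth z (now k)))%:E))%E by [].
elim/big_rec2 : _ => [|k e p _ [p_ge0 IH]]; first by rewrite lne1.
have gt0 : 0 <= gauss_factor th x z k *
    trans_prob th (tnth z (next k)) (tnth z (now k)).
  exact: mulr_ge0.
by split; [exact: mulr_ge0|rewrite (lneMr _ _ gt0 p_ge0) lneMr// IH].
Qed.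

(* p_th(y_{1:N}); the observations y are fixed. *)
Definition evidence (th : param) : R :=
  fine (\sum_(z : modes) \int[leb_traj N.+1]_x (joint_pdf th x z)%:E)%E.

(* p_th(x_{1:N+1}, z_{1:N+1} | y_{1:N}). *)
Definition smoothed_pdf (th : param) (x : traj N.+1) (z : modes) : R :=
  joint_pdf th x z / evidence th.

(* lne 0 = -oo (whereas ln 0 = 0), and -oo * 0 = 0 in \bar R, so trajectories of
   zero probability under th count as -oo exactly when they have positive
   smoothed density under th'. *)
Definition Qfun (th th' : param) : \bar R :=
  (\sum_(z : modes) \int[leb_traj N.+1]_x
     (lne (joint_pdf th x z)%:E * (smoothed_pdf th' x z)%:E))%E.

(* p_th(x_1, z_1 | y_{1:N}). *)
Definition smoothed_init_pdf (th : param) (x1 : state) (z1 : 'I_m) : R :=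
  \sum_(z : modes | tnth z ord0 == z1)
    \int[leb_traj N]_t smoothed_pdf th [tuple of x1 :: t] z.

(* The trajectory whose states at times k and k + 1 are a and b, and whose other
   states are listed in order by t. *)
Definition insert_pair (k : 'I_N) (a b : state) (t : traj N.-1) : traj N.+1 :=
  [tuple nth a (take k t ++ a :: b :: drop k t) i | i < N.+1].

(* p_th(x_{k+1} = x', z_{k+1} = z', x_k = x, z_k = z | y_{1:N}). *)
Definition smoothed_pair_pdf (th : param) (k : 'I_N)
    (x : state) (z : 'I_m) (x' : state) (z' : 'I_m) : R :=
  \sum_(zs : modes | (tnth zs (now k) == z) && (tnth zs (next k) == z'))
    \int[leb_traj N.-1]_t smoothed_pdf th (insert_pair k x x' t) zs.

(* w l z z', mu l z z' and P l z z' (at time k) belong to z_k = z, z_{k+1} = z'. *)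
Section mixture.
Variable MS : 'I_N -> nat.
Variable w : forall k : 'I_N, 'I_(MS k) -> 'I_m -> 'I_m -> R.
Variable mu : forall k : 'I_N, 'I_(MS k) -> 'I_m -> 'I_m -> 'cV[R]_(nx + nx).
Variable P : forall k : 'I_N, 'I_(MS k) -> 'I_m -> 'I_m -> 'M[R]_(nx + nx).

(* Densities are compared up to Lebesgue-null sets. *)
Definition is_smoothed_mixture (th : param) : Prop :=
  [/\ forall k l z z', 0 <= @w k l z z',
      forall k l z z', pos_def (@P k l z z') &
      forall (k : 'I_N) (z z' : 'I_m),
        {ae leb_pair, forall xx,
          smoothed_pair_pdf th k xx.1 z xx.2 z' =
          \sum_(l < MS k) w l z z' *
            gauss_pdf (mu l z z') (P l z z') (col_mx (vec xx.1) (vec xx.2))}].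

Definition cm (z : 'I_m) : R :=
  \sum_(k < N) \sum_(j < m) \sum_(l < MS k) w l z j.

(* E_k^{z,j,l}[f(X_k, X_{k+1})]. *)
Definition expect (k : 'I_N) (z j : 'I_m) (l : 'I_(MS k))
    (f : state -> state -> R) : R :=
  \int[leb_pair]_xx (f xx.1 xx.2 *
    gauss_pdf (mu l z j) (P l z j) (col_mx (vec xx.1) (vec xx.2))).

Definition stacked (k : 'I_N) (x x' : state) :
    'cV[R]_(nx + (nx + (nu + ny))) :=
  col_mx (vec x) (col_mx (vec x') (col_mx (u k) (y k))).

Definition Mmx (z : 'I_m) : 'M[R]_(nx + (nx + (nu + ny))) :=
  \sum_(k < N) \sum_(j < m) \sum_(l < MS k) w l z j *:
    \matrix_(a, b) expect z j l
      (fun x x' => (stacked k x x' *m (stacked k x x')^T) a b).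

End mixture.
End data.

Definition T1 : 'M[R]_(nx + nu, nx + (nx + (nu + ny))) :=
  col_mx (row_mx 1%:M (row_mx 0 (row_mx 0 0)))
         (row_mx 0 (row_mx 0 (row_mx 1%:M 0))).

Definition T2 : 'M[R]_(ny + nx, nx + (nx + (nu + ny))) :=
  col_mx (row_mx 0 (row_mx 0 (row_mx 0 1%:M)))
         (row_mx 0 (row_mx 1%:M (row_mx 0 0))).

Section formulas.
Variables (r : nat) (Mh : 'M[R]_(r, nx + (nx + (nu + ny)))).

Definition Sigma : 'M[R]_(nx + nu) := T1 *m Mh^T *m Mh *m T1^T.
Definition Phi : 'M[R]_(ny + nx) := T2 *m Mh^T *m Mh *m T2^T.
Definition Psi : 'M[R]_(ny + nx, nx + nu) := T2 *m Mh^T *m Mh *m T1^T.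

Definition Gam_opt : 'M[R]_(ny + nx, nx + nu) := Psi *m invmx Sigma.

Definition Pi_half (c : R) (G : 'M[R]_(ny + nx, nx + nu)) : 'M[R]_(r, ny + nx) :=
  (Num.sqrt c)^-1 *: (Mh *m
    col_mx (row_mx (- (Cmat G)^T) (- (Amat G)^T))
   (col_mx (row_mx 0 1%:M)
   (col_mx (row_mx (- (Dmat G)^T) (- (Bmat G)^T))
           (row_mx 1%:M 0)))).

End formulas.
End jump_markov_linear_system.

(* Main.v *)
Require Import Defs.
From HB Require Import structures.
From mathcomp Require Import all_boot all_order all_algebra.
From mathcomp Require Import all_classical all_reals all_analysis.
From mathcomp Require Import measurable_realfun zify ring lra.

Set Implicit Arguments.
Unset Strict Implicit.
Unset Printing Implicit Defensive.
Import Order.TTheory GRing.Theory Num.Theory.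
Import numFieldNormedType.Exports.
Local Open Scope classical_set_scope.
Local Open Scope ring_scope.

(* The log-likelihood splits into a term in p(x_1, z_1), Gaussian terms and
   transition terms, and its expectation under the smoothed law of theta' is
   maximised term by term.  The initial and transition terms are handled by Gibbs'
   inequality in the pointwise form ln r <= r - 1, which makes sense for candidate parameters
   whose integrals diverge.  The Gaussian terms depend on theta' only through
   c_m(z) and M(z): completing the square around Psi Sigma^-1 gives Gamma, and
   n + ln det Pi0 <= ln det Pi + tr (Pi^-1 Pi0) gives Pi = Pi0.
   The optimal value must be shown finite: the smoothed density of (x_1, z_1) is
   a.e. a Gaussian mixture, hence bounded above and bounded below by a positive
   multiple of a single Gaussian density.  Mode sequences of zero smoothed
   mass contribute nothing, and along all others the optimal densities and
   transition probabilities are positive. *)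

(** * Positive definite matrices *)

(** The difference of the two values of [Qfun] cannot be formed, since the candidate's may be
    infinite. Instead the candidate's log-density is majorised pointwise by an integrable function
    [Hs + Ds], where [Hs] integrates to the optimal value and the integrals of [Ds], summed over the
    mode sequences, are at most 0. The mixture hypothesis speaks of two consecutive times only, and
    only almost everywhere. Every expectation is therefore brought to a function of one pair of
    states and their modes, then integrated against Gaussian components ([integral_smoothed_pair]).
    The initial term is read off the pair at the first two times. [smoothed_init_pdf] is built from
    real-valued integrals, which are 0 where the true integral is infinite, so it can vanish on a
    null set. Pointwise comparisons use [init_mixture] instead, which is positive at every point for
    the mode sequences that count; the two are exchanged only under an integral. Positivity of [cm]
    also supplies nondegeneracy: [N] is positive and the evidence is nonzero, so that dividing by it
    yields a probability law. *)

Section positive_definite.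
Context {R : realType}.

Definition qform n (P : 'M[R]_n) (v : 'cV[R]_n) : R := (v^T *m P *m v) 0 0.

Lemma trmx_scale n p (c : R) (A : 'M[R]_(n, p)) : (c *: A)^T = c *: A^T.
Proof. by apply/matrixP => i j; rewrite !mxE. Qed.

Lemma qform_congr n p (L : 'M[R]_(n, p)) (P : 'M[R]_p) (v : 'cV[R]_n) :
  qform (L *m P *m L^T) v = qform P (L^T *m v).
Proof. by rewrite /qform trmx_mul trmxK !mulmxA. Qed.

Lemma qform_sum n (P : 'M[R]_n) (v : 'cV[R]_n) :
  qform P v = \sum_i \sum_j P i j * (v i 0 * v j 0).
Proof.
rewrite /qform mxE exchange_big; apply: eq_bigr => j _ /=.
rewrite mxE mulr_suml; apply: eq_bigr => i _.
by rewrite !mxE; ring.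
Qed.

Lemma qform_block_diag a b (P : 'M[R]_a) (S : 'M[R]_b) x1 x2 :
  qform (block_mx P 0 0 S) (col_mx x1 x2) = qform P x1 + qform S x2.
Proof.
rewrite /qform tr_col_mx mul_row_block !mulmx0 addr0 add0r mul_row_col.
by rewrite mxE.
Qed.

Lemma qform0 n (P : 'M[R]_n) : qform P 0 = 0.
Proof. by rewrite /qform mulmx0 mxE. Qed.

Lemma qformBZ n (P : 'M[R]_n) (v w : 'cV[R]_n) (c : R) : qform P (v - c *: w) =
  qform P v - c * (v^T *m P *m w) 0 0 - c * (w^T *m P *m v) 0 0 +
  c ^+ 2 * qform P w.
Proof.
have tB : (v - c *: w)^T = v^T - c *: w^T.
  by apply/matrixP => i j; rewrite !mxE.
rewrite /qform tB mulmxBr !mulmxBl !(=^~ scalemxAl, =^~ scalemxAr).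
set X := v^T *m P *m v; set Y := v^T *m _ *m w; set Z := w^T *m _ *m v.
by set W := w^T *m _ *m w; rewrite !mxE; ring.
Qed.

Lemma pos_def_qform_ge0 n (P : 'M[R]_n) v : pos_def P -> 0 <= qform P v.
Proof.
case=> _ P0; have [->|v0] := eqVneq v 0; first by rewrite qform0.
exact/ltW/P0.
Qed.

Lemma pos_def_unit n (P : 'M[R]_n) : pos_def P -> P \in unitmx.
Proof.
case=> Psym P0; rewrite unitmxE unitfE; apply/det0P => -[v v0 vP].
have := P0 v^T; rewrite trmxK vP mul0mx mxE ltxx trmx_eq0 v0 => /(_ isT).
by [].
Qed.

Lemma pos_def_congr n (L P : 'M[R]_n) :
  L \in unitmx -> pos_def P -> pos_def (L *m P *m L^T).
Proof.
move=> Lu [Psym P0]; split; first by rewrite !trmx_mul trmxK Psym mulmxA.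
move=> v v0; rewrite -/(qform _ v) qform_congr; apply: P0.
apply: contra v0 => /eqP /(congr1 (mulmx (invmx L^T))).
by rewrite mulmx0 mulKmx ?unitmx_tr// => ->.
Qed.

Lemma pos_def_inv n (P : 'M[R]_n) : pos_def P -> pos_def (invmx P).
Proof.
move=> Ppd; have Pu := pos_def_unit Ppd.
have := @pos_def_congr _ (invmx P) P; rewrite unitmx_inv Pu trmx_inv.
by rewrite Ppd.1 mulVmx// mul1mx; exact.
Qed.

Lemma pos_defZ n (P : 'M[R]_n) c : 0 < c -> pos_def P -> pos_def (c *: P).
Proof.
move=> c0 [Psym P0]; split; first by rewrite linearZ /= Psym.
by move=> v v0; rewrite -scalemxAr -scalemxAl mxE mulr_gt0// P0.
Qed.

Lemma pos_def_block_diag a b (P : 'M[R]_a) (S : 'M[R]_b) :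
  pos_def (block_mx P 0 0 S) <-> pos_def P /\ pos_def S.
Proof.
split.
  case; rewrite tr_block_mx => /eq_block_mx[Psym _ _ Ssym] P0.
  split; split => // v v0.
    have := P0 (col_mx v 0); rewrite -/(qform _ _) qform_block_diag qform0 addr0.
    by apply; rewrite col_mx_eq0 (negbTE v0).
  have := P0 (col_mx 0 v); rewrite -/(qform _ _) qform_block_diag qform0 add0r.
  by apply; rewrite col_mx_eq0 (negbTE v0) andbF.
move=> [Ppd Spd]; split.
  by rewrite tr_block_mx !trmx0 Ppd.1 Spd.1.
move=> v; rewrite -[v]vsubmxK col_mx_eq0 negb_and -/(qform _ _) qform_block_diag.
case/orP => v0.
  by rewrite ltr_pwDl ?Ppd.2// pos_def_qform_ge0.
by rewrite ltr_wpDl ?Spd.2// pos_def_qform_ge0.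
Qed.

(** If [P] is the covariance of a Gaussian pair, this Schur complement is the covariance of the
    second part conditioned on the first. *)
Definition schur a b (P : 'M[R]_(a + b)) : 'M[R]_b :=
  drsubmx P - dlsubmx P *m invmx (ulsubmx P) *m ursubmx P.

Definition schur_low a b (P : 'M[R]_(a + b)) : 'M[R]_(a + b) :=
  block_mx 1%:M 0 (dlsubmx P *m invmx (ulsubmx P)) 1%:M.

Lemma schur_low_unit a b (P : 'M[R]_(a + b)) : schur_low P \in unitmx.
Proof. by rewrite unitmxE det_lblock !det1 mulr1 unitr1. Qed.

Lemma pos_def_ul a b (P : 'M[R]_(a + b)) : pos_def P -> pos_def (ulsubmx P).
Proof.
rewrite -{1}[P]submxK => -[]; rewrite tr_block_mx => /eq_block_mx[Psym _ _ _] P0.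
split=> // v v0; have := P0 (col_mx v 0).
rewrite tr_col_mx trmx0 mul_row_block mul_row_col !mul0mx !mulmx0 !addr0.
by apply; rewrite col_mx_eq0 (negbTE v0).
Qed.

Lemma schur_LDL a b (P : 'M[R]_(a + b)) : pos_def P ->
  P = schur_low P *m block_mx (ulsubmx P) 0 0 (schur P) *m (schur_low P)^T.
Proof.
move=> Ppd; have P1u := pos_def_unit (pos_def_ul Ppd).
have /eq_block_mx[ulT urT dlT _] : (block_mx (ulsubmx P)^T (dlsubmx P)^T (ursubmx P)^T
  (drsubmx P)^T = block_mx (ulsubmx P) (ursubmx P) (dlsubmx P) (drsubmx P)).
  by rewrite -tr_block_mx !submxK Ppd.1.
rewrite /schur_low tr_block_mx !trmx1 !trmx0 !mulmx_block.
rewrite trmx_mul trmx_inv ulT urT.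
rewrite !(mul1mx, mulmx1, mulmx0, mul0mx, addr0, add0r).
by rewrite mulKVmx// mulmxKV// /schur mulmxA addrC subrK submxK.
Qed.

(** Congruence by the inverse of [schur_low P] makes [P] block diagonal with [schur P] as its second
    diagonal block. *)
Lemma pos_def_schur a b (P : 'M[R]_(a + b)) : pos_def P -> pos_def (schur P).
Proof.
move=> Ppd; set L := schur_low P.
have Lu : invmx L \in unitmx by rewrite unitmx_inv schur_low_unit.
have := pos_def_congr Lu Ppd; rewrite [X in invmx L *m X](schur_LDL Ppd) -/L trmx_inv.
rewrite !mulmxA mulVmx ?schur_low_unit// mul1mx mulmxK ?unitmx_tr ?schur_low_unit//.
by move/pos_def_block_diag => [].
Qed.

Lemma det_schur a b (P : 'M[R]_(a + b)) : pos_def P ->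
  \det P = \det (ulsubmx P) * \det (schur P).
Proof.
move=> Ppd; rewrite {1}(schur_LDL Ppd) !det_mulmx det_tr det_lblock !det1.
by rewrite det_ublock !mul1r mulr1.
Qed.

Lemma invmx_unique n (A B : 'M[R]_n) : A *m B = 1%:M -> invmx A = B.
Proof.
by move=> AB; have [Au _] := mulmx1_unit AB; rewrite -[B](mulKmx Au) AB mulmx1.
Qed.

(** The substitution [col_mx x1 x2 = schur_low P *m z] makes the form block diagonal; the second
    part of [z] is the residual of [x2] regressed on [x1]. *)
Lemma qform_inv_schur a b (P : 'M[R]_(a + b)) x1 x2 : pos_def P ->
  qform (invmx P) (col_mx x1 x2) = qform (invmx (ulsubmx P)) x1 +
  qform (invmx (schur P)) (x2 - dlsubmx P *m invmx (ulsubmx P) *m x1).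
Proof.
move=> Ppd; have P1u := pos_def_unit (pos_def_ul Ppd).
have Su := pos_def_unit (pos_def_schur Ppd).
rewrite -qform_block_diag; set D := block_mx _ _ _ _; set z := col_mx x1 (_ - _).
have -> : col_mx x1 x2 = schur_low P *m z.
  by rewrite mul_block_col !mul1mx mul0mx addr0 addrC subrK.
set L := schur_low P; have Lu : L \in unitmx by exact: schur_low_unit.
rewrite -[X in X *m z]trmxK -qform_congr trmxK.
suff -> : invmx P = invmx L^T *m D *m invmx L.
  by rewrite !mulmxA mulmxV ?unitmx_tr// mul1mx mulmxKV.
apply: invmx_unique; rewrite {1}(schur_LDL Ppd) -/L !mulmxA mulmxK ?unitmx_tr//.
rewrite -[L *m _ *m D]mulmxA /D mulmx_block.
by rewrite !(mulmx0, mul0mx, addr0, add0r) !mulmxV// -scalar_mx_block mulmx1 mulmxV.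
Qed.

Lemma det_pos_def n (P : 'M[R]_n) : pos_def P -> 0 < \det P.
Proof.
elim: n P => [|n IH] P Ppd; first by rewrite det_mx00.
rewrite (@det_schur 1 n)// mulr_gt0 ?IH//; last exact: (@pos_def_schur 1 n).
have [_ /(_ 1%:M)] := @pos_def_ul 1 n P Ppd.
rewrite trmx1 mul1mx mulmx1 det_mx11; apply.
by apply/eqP => /matrixP/(_ 0 0)/eqP; rewrite !mxE oner_eq0.
Qed.

(* Cauchy-Schwarz in the inner product of P^-1, applied to v and P e_i. *)
Lemma sqr_coord_le_qform_inv n (P : 'M[R]_n) (v : 'cV[R]_n) i : pos_def P ->
  v i 0 ^+ 2 <= P i i * qform (invmx P) v.
Proof.
move=> Ppd; have Pu := pos_def_unit Ppd.
pose e : 'cV[R]_n := delta_mx i 0.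
have PiiE : qform P e = P i i.
  rewrite /qform /e trmx_delta -rowE -colE !mxE//.
have Pii0 : 0 < P i i.
  rewrite -PiiE; apply: Ppd.2; apply/eqP => /matrixP/(_ i 0)/eqP.
  by rewrite !mxE !eqxx oner_eq0.
(* This [t] minimises the form of [invmx P] at [v - t *: (P *m e)]; the minimum is
   [q - v_i ^ 2 / P i i]. *)
pose t := v i 0 / P i i.
have := pos_def_qform_ge0 (v - t *: (P *m e)) (pos_def_inv Ppd).
rewrite qformBZ trmx_mul Ppd.1 !mulmxA.
rewrite -[v^T *m invmx P *m P]mulmxA mulVmx// mulmx1.
rewrite -[e^T *m P *m invmx P]mulmxA mulmxV// mulmx1.
have -> : qform (invmx P) (P *m e) = qform P e.
  by rewrite /qform trmx_mul Ppd.1 !mulmxA mulmxK.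
rewrite PiiE !mxE.
have -> : \sum_j (v^T 0 j * e j 0) = v i 0.
  rewrite (bigD1 i)//= !mxE !eqxx mulr1 big1 ?addr0// => j ji.
  by rewrite !mxE (negbTE ji) mulr0.
have -> : \sum_j (e^T 0 j * v j 0) = v i 0.
  rewrite (bigD1 i)//= !mxE !eqxx mul1r big1 ?addr0// => j ji.
  by rewrite !mxE (negbTE ji) mul0r.
set q := qform (invmx P) v.
rewrite -(@ler_pM2l _ (P i i))// mulr0.
suff -> : P i i * (q - t * v i 0 - t * v i 0 + t ^+ 2 * P i i) =
  P i i * q - v i 0 ^+ 2 by rewrite subr_ge0.
by rewrite /t; field; rewrite gt_eqF.
Qed.

End positive_definite.

(** * Determinant and trace inequalities *)

Section determinant_trace.
Context {R : realType}.

(** A factor of the Schur complement, one dimension smaller, is extended by the square root of the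
    corner entry. Only invertibility of [L] is recorded, since it serves to form congruences. *)
Lemma cholesky n (P : 'M[R]_n) : pos_def P ->
  exists2 L : 'M[R]_n, L \in unitmx & L *m L^T = P.
Proof.
elim: n P => [|n IH] P Ppd.
  by exists 1%:M; [exact: unitmx1|apply/matrixP => -[]].
have [L' L'u L'E] := IH _ (@pos_def_schur _ 1 n P Ppd).
have := @pos_def_ul _ 1 n P Ppd; set a := @ulsubmx _ 1 n 1 n P => apd.
have a0 : 0 < a 0 0 by have := det_pos_def apd; rewrite det_mx11.
pose K : 'M[R]_(1 + n) := block_mx (Num.sqrt (a 0 0))%:M 0 0 L'.
exists (@schur_low _ 1 n P *m K).
  have Ku : K \in unitmx.
    rewrite unitmxE det_ublock det_scalar1 unitrM.
    by rewrite -[\det L' \is a _]unitmxE L'u unitfE gt_eqF// sqrtr_gt0.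
  by rewrite unitmx_mul (@schur_low_unit _ 1 n P) Ku.
rewrite [RHS](@schur_LDL _ 1 n P Ppd) trmx_mul !mulmxA; congr (_ *m _).
rewrite -mulmxA; congr (_ *m _).
suff KK : K *m K^T = block_mx a 0 0 (L' *m L'^T) by rewrite -L'E; exact: KK.
rewrite /K tr_block_mx !trmx0 mulmx_block !(mul0mx, mulmx0, addr0, add0r).
by rewrite tr_scalar_mx -scalar_mxM -expr2 sqr_sqrtr ?ltW// -mx11_scalar.
Qed.

Lemma mxtrace_mul_tr_ge0 n p (Y : 'M[R]_(n, p)) : 0 <= \tr (Y *m Y^T).
Proof.
apply: sumr_ge0 => i _; rewrite mxE; apply: sumr_ge0 => j _.
by rewrite mxE -expr2 sqr_ge0.
Qed.

Lemma mxtrace_qform_ge0 n p (Y : 'M[R]_(n, p)) (Q : 'M[R]_p) :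
  pos_def Q -> 0 <= \tr (Y *m Q *m Y^T).
Proof.
move=> /cholesky[L _ <-].
by rewrite mulmxA -mulmxA -trmx_mul mxtrace_mul_tr_ge0.
Qed.

Lemma ln_le_subr1 (x : R) : 0 < x -> ln x <= x - 1.
Proof.
move=> x0; have := @le_ln1Dx R (x - 1).
by rewrite [1 + _]addrC subrK; apply; rewrite ltrBrDl subrr.
Qed.

(** Induction along Schur complements takes the place of eigenvalues: the corner contributes
    [ln a <= a - 1], and passing from the lower right block to [schur] only lowers the trace, by the
    trace of some [Y *m Q *m Y^T] with [Q] positive definite. *)
Lemma ln_det_le_mxtrace n (A : 'M[R]_n) : pos_def A ->
  ln (\det A) <= \tr A - n%:R.
Proof.
elim: n A => [|n IH] A Apd.
  by rewrite det_mx00 ln1 /mxtrace big_ord0 subr0.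
have apd := @pos_def_ul _ 1 n A Apd; have Spd := @pos_def_schur _ 1 n A Apd.
rewrite (@det_schur _ 1 n)// lnM ?posrE ?det_pos_def//.
have a_le : ln (\det (@ulsubmx _ 1 n 1 n A)) <= \tr (@ulsubmx _ 1 n 1 n A) - 1.
  rewrite {2}[@ulsubmx _ 1 n 1 n A]mx11_scalar mxtrace_scalar mulr1n.
  rewrite -det_mx11; exact/ln_le_subr1/det_pos_def.
have S_le : \tr (@schur _ 1 n A) <= \tr (@drsubmx _ 1 n 1 n A).
  rewrite raddfB /= gerBl.
  have -> : @ursubmx _ 1 n 1 n A = (@dlsubmx _ 1 n 1 n A)^T.
    by rewrite trmx_dlsub Apd.1.
  exact/mxtrace_qform_ge0/pos_def_inv.
have := IH _ Spd.
have -> : \tr A = \tr (@ulsubmx _ 1 n 1 n A) + \tr (@drsubmx _ 1 n 1 n A).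
  by rewrite -(@mxtrace_block _ 1 n _ (@ursubmx _ 1 n 1 n A) (@dlsubmx _ 1 n 1 n A)) submxK.
rewrite -natr1; lra.
Qed.

(** With [A = L *m L^T], the congruent matrix [L^-1 B L^-T] has determinant [\det B / \det A] and,
    by cyclicity, trace [\tr (invmx A *m B)]; [ln_det_le_mxtrace] applies to it. *)
Lemma ln_det_mxtrace_min n (A B : 'M[R]_n) : pos_def A -> pos_def B ->
  n%:R + ln (\det B) <= ln (\det A) + \tr (invmx A *m B).
Proof.
move=> Apd Bpd; have [L Lu LE] := cholesky Apd.
have Liu : invmx L \in unitmx by rewrite unitmx_inv.
have := ln_det_le_mxtrace (pos_def_congr Liu Bpd).
have AiE : invmx A = (invmx L)^T *m invmx L.
  apply: invmx_unique; rewrite -LE mulmxA trmx_inv mulmxK ?unitmx_tr//.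
  exact: mulmxV.
rewrite mxtrace_mulC mulmxA -AiE !det_mulmx det_tr.
have dA : \det A = \det L ^+ 2 by rewrite -LE det_mulmx det_tr.
rewrite det_inv; have dL0 : \det L != 0 by rewrite -unitfE -unitmxE.
have -> : (\det L)^-1 * \det B * (\det L)^-1 = \det B / \det A.
  by rewrite dA; field.
rewrite ln_div ?posrE ?det_pos_def//; lra.
Qed.

End determinant_trace.

(** * QR decomposition *)

Section qr.
Context {R : realType}.

(* The reflection exchanging v and |v| e_1. *)
Lemma householder n (v : 'cV[R]_(1 + n)) :
  exists H : 'M[R]_(1 + n), H^T *m H = 1%:M /\ dsubmx (H *m v) = 0.
Proof.
pose nv := Num.sqrt ((v^T *m v) 0 0).
have vv_ge0 p (x : 'cV[R]_p) : 0 <= (x^T *m x) 0 0.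
  by rewrite mxE sumr_ge0// => i _; rewrite mxE -expr2 sqr_ge0.
have nv2 : nv ^+ 2 = (v^T *m v) 0 0 by rewrite sqr_sqrtr.
pose e : 'cV[R]_(1 + n) := col_mx 1%:M 0.
pose w := v - nv *: e; pose d := (w^T *m w) 0 0.
have ee : (e^T *m e) 0 0 = 1.
  by rewrite /e tr_col_mx mul_row_col trmx0 mul0mx addr0 trmx1 mul1mx mxE.
have de : dsubmx e = 0 by rewrite /e col_mxKd.
have ev : (e^T *m v) 0 0 = (v^T *m e) 0 0.
  have -> : e^T *m v = (v^T *m e)^T by rewrite trmx_mul trmxK.
  by rewrite mxE.
have wv : (w^T *m v) 0 0 = nv ^+ 2 - nv * (v^T *m e) 0 0.
  rewrite /w linearB /= linearZ /= mulmxBl -scalemxAl nv2 -ev.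
  by rewrite !mxE.
have dE : d = 2 * (nv ^+ 2 - nv * (v^T *m e) 0 0).
  have := qformBZ 1%:M v e nv; rewrite /qform !mulmx1 -/w -/d ee ev -nv2 => ->.
  ring.
(* The reflection divides by [d], the squared norm of [w]. If [d] vanishes then [v = nv *: e]
   already, and the identity serves. *)
have [d0|d0] := eqVneq d 0.
  exists 1%:M; rewrite trmx1 mulmx1 mul1mx; split => //.
  have w0 i : w i 0 = 0.
    move/eqP: d0; rewrite /d mxE psumr_eq0; last first.
      by move=> j _; rewrite mxE -expr2 sqr_ge0.
    move/allP => /(_ i); rewrite mem_index_enum => /(_ isT)/=.
    by rewrite mxE -expr2 sqrf_eq0 => /eqP.
  have vE : v = nv *: e.
    by apply/matrixP => i j; rewrite ord1; apply/eqP; rewrite -subr_eq0;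
       have := w0 i; rewrite /w !mxE => ->.
  by rewrite vE linearZ /= de scaler0.
(* By [wv] and [dE] the product of [w^T] and [v] is [d / 2], so this reflection subtracts exactly
   [w] from [v] and leaves [nv *: e]. *)
exists (1%:M - (2 / d) *: (w *m w^T)); split.
  have -> : (1%:M - (2 / d) *: (w *m w^T))^T = 1%:M - (2 / d) *: (w *m w^T).
    by rewrite linearB /= linearZ /= trmx1 trmx_mul trmxK.
  rewrite mulmxBl mul1mx mulmxBr mulmx1 -scalemxAl -scalemxAr.
  have -> : w *m w^T *m (w *m w^T) = d *: (w *m w^T).
    by rewrite mulmxA -[w *m w^T *m w]mulmxA [w^T *m w]mx11_scalar -/d
      mul_mx_scalar -scalemxAl.
  rewrite !scalerA; move: (w *m w^T) => W.
  have -> : 2 / d * (2 / d) * d = 2 / d + 2 / d by field.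
  by apply/matrixP => i j; rewrite !mxE; ring.
rewrite mulmxBl mul1mx -scalemxAl -mulmxA [w^T *m v]mx11_scalar mul_mx_scalar.
rewrite scalerA wv.
have -> : 2 / d * (nv ^+ 2 - nv * (v^T *m e) 0 0) = 1.
  by rewrite mulrAC -dE divff.
by rewrite scale1r /w opprB addrC subrK linearZ /= de scaler0.
Qed.

(** A Householder reflection clears the first column below its top entry, and the induction
    continues on the lower right block. The number of rows varies along the induction, so [X] may be
    tall or wide. *)
Lemma qless_QR_exists r n (X : 'M[R]_(r, n)) : exists O, is_qless_QR O X.
Proof.
elim: n r X => [|n IH] [|r] X.
- by exists 1%:M; split; [rewrite trmx1 mulmx1|move=> []].
- by exists 1%:M; split; [rewrite trmx1 mulmx1|move=> i []].
- by exists 1%:M; split; [rewrite trmx1 mulmx1|move=> []].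
have [H [HH Hv]] := householder (@lsubmx _ _ 1 n X : 'cV[R]_(1 + r)).
pose Y : 'M[R]_(1 + r, 1 + n) := H *m X.
have [U [OO OY]] := IH _ (drsubmx Y).
pose O : 'M[R]_(1 + r) := block_mx 1%:M 0 0 U *m H.
exists O; split.
  suff OOE : O^T *m O = 1%:M by exact: OOE.
  rewrite /O trmx_mul -mulmxA [X in _ *m X]mulmxA tr_block_mx !trmx0 trmx1.
  rewrite mulmx_block !(mul0mx, mulmx0, addr0, add0r) OO mulmx1 -scalar_mx_block.
  by rewrite mul1mx.
have Ydl : @dlsubmx _ 1 r 1 n Y = 0.
  have dl (A : 'M[R]_(1 + r, 1 + n)) : dlsubmx A = dsubmx (lsubmx A).
    by apply/matrixP => i j; rewrite !mxE.
  by rewrite dl /Y -mulmx_lsub; exact: Hv.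
have YE : Y = block_mx (ulsubmx Y) (ursubmx Y) 0 (drsubmx Y) by rewrite -Ydl submxK.
have -> : O *m X = block_mx 1%:M 0 0 U *m Y by rewrite /O /Y mulmxA.
rewrite YE mulmx_block.
rewrite !(mul0mx, mulmx0, addr0, add0r) mul1mx => i j.
rewrite -(splitK (i : 'I_(1 + r))) -(splitK (j : 'I_(1 + n))).
case: splitP => i' ii'; case: splitP => j' jj' /=; rewrite ?ord1 //=.
- by move=> _; transitivity ((0 : 'M[R]_(r, 1)) j' 0); [exact: block_mxEdl|rewrite mxE].
- rewrite !add1n ltnS => /OY <-; exact: block_mxEdr.
Qed.

Lemma qless_QR_sqrt_factor r n (X : 'M[R]_(r, n)) O :
  is_qless_QR O X -> is_sqrt_factor (O *m X) (X^T *m X).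
Proof.
case=> OO _; rewrite /is_sqrt_factor trmx_mul -mulmxA [X in _ *m X]mulmxA OO.
by rewrite mul1mx.
Qed.

Lemma mxcol_sqrt_factor (n p : nat) (q : 'I_p -> nat) (a : 'I_p -> R)
    (A : forall i : 'I_p, 'M[R]_(q i, n)) : (forall i, 0 <= a i) ->
  let X := \mxcol_(i < p) (Num.sqrt (a i) *: A i) in
  X^T *m X = \sum_(i < p) a i *: ((A i)^T *m A i).
Proof.
move=> a0 /=; rewrite tr_mxcol mul_mxrow_mxcol; apply: eq_bigr => i _.
by rewrite trmx_scale -scalemxAl -scalemxAr scalerA -expr2 sqr_sqrtr.
Qed.

End qr.

(** * Prediction errors *)

Section regression.
Context {R : realType}.
Variables (nx nu ny r : nat) (Mh : 'M[R]_(r, nx + (nx + (nu + ny)))).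
Implicit Types G : 'M[R]_(ny + nx, nx + nu).

(* The matrix taking (x_k, x_{k+1}, u_k, y_k) to the prediction error
   (y_k, x_{k+1}) - G (x_k, u_k). *)
Definition residual_mx G : 'M[R]_(ny + nx, nx + (nx + (nu + ny))) :=
  @T2 R nx nu ny - G *m @T1 R nx nu ny.

(** When [Mh^T *m Mh] is the moment matrix of a mode, this is the weighted sum of the expected outer
    squares of the prediction errors. *)
Definition residual_moment G : 'M[R]_(ny + nx) :=
  residual_mx G *m (Mh^T *m Mh) *m (residual_mx G)^T.

(** The block column in [Pi_half] is the transpose of [residual_mx G] written out; hence, for
    [0 < c], the Gram matrix of [Pi_half Mh c G] is [residual_moment G] divided by [c]. *)
Lemma Pi_half_residual c G :
  Pi_half Mh c G = (Num.sqrt c)^-1 *: (Mh *m (residual_mx G)^T).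
Proof.
congr (_ *: (_ *m _)); rewrite -[in RHS](submxK G).
rewrite /residual_mx /T2 /T1 mul_block_col !mul_mx_row !(mulmx0, mulmx1).
rewrite !add_row_mx !(addr0, add0r) opp_col_mx add_col_mx !opp_row_mx.
rewrite !add_row_mx !oppr0 !(addr0, add0r).
rewrite tr_col_mx !tr_row_mx.
have trN n p (A : 'M[R]_(n, p)) : (- A)^T = - A^T.
  by apply/matrixP => i j; rewrite !mxE.
by do 3 rewrite -[in RHS]block_mxEh [in RHS]block_mxEv; rewrite !trN !trmx0 !trmx1.
Qed.

(** These are the normal equations: the residual at [Gam_opt] is orthogonal to the regressors
    selected by [T1] in the moment form, because [Psi - Psi Sigma^-1 Sigma = 0], so the cross terms
    vanish. *)
Lemma residual_moment_Gam_opt G : Sigma Mh \in unitmx ->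
  residual_moment G = residual_moment (Gam_opt Mh) +
    (G - Gam_opt Mh) *m Sigma Mh *m (G - Gam_opt Mh)^T.
Proof.
move=> Su; set D := G - _; set K := residual_mx (Gam_opt Mh).
(* The Gram matrix is hidden behind an opaque symmetric [M], so that reassociating products does not
   break it apart. *)
have [M [ME MT]] : exists M, M = Mh^T *m Mh /\ M^T = M.
  by exists (Mh^T *m Mh); rewrite trmx_mul trmxK.
have KE : residual_mx G = K - D *m @T1 R nx nu ny.
  by rewrite /K /D /residual_mx mulmxBl opprB addrA subrK.
have cross : K *m M *m (@T1 R nx nu ny)^T = 0.
  rewrite /K /residual_mx !mulmxBl /Gam_opt ME.
  have -> : @T2 R nx nu ny *m (Mh^T *m Mh) *m (@T1 R nx nu ny)^T = Psi Mh.
    by rewrite /Psi !mulmxA.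
  have -> : Psi Mh *m invmx (Sigma Mh) *m @T1 R nx nu ny *m (Mh^T *m Mh) *m
      (@T1 R nx nu ny)^T = Psi Mh *m invmx (Sigma Mh) *m Sigma Mh.
    by rewrite /Sigma !mulmxA.
  by rewrite mulmxKV// subrr.
have cross' : @T1 R nx nu ny *m M *m K^T = 0.
  by have := congr1 trmx cross; rewrite !trmx_mul trmxK MT trmx0 mulmxA.
rewrite /residual_moment KE -/K -ME; clearbody K D; rewrite linearB /= trmx_mul.
rewrite !mulmxBl !mulmxBr !mulmxA cross mul0mx subr0.
have -> : D *m @T1 R nx nu ny *m M *m K^T = 0.
  by rewrite -[LHS]mulmxA -[LHS]mulmxA [X in D *m X]mulmxA cross' mulmx0.
rewrite sub0r opprK.
by congr (_ + _); rewrite /Sigma ME !mulmxA.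
Qed.

(** The optimal residual moment is [c *: (Ph^T *m Ph)], so the left trace equals [c] times the
    dimension. On the right the excess over [Gam_opt] has a nonnegative trace, and
    [ln_det_mxtrace_min] scaled by [c] bounds the rest. *)
Lemma Gam_opt_Pi_half_min c G (A : 'M[R]_(ny + nx)) :
  let Ph := Pi_half Mh c (Gam_opt Mh) in
  0 < c -> Sigma Mh \in unitmx -> pos_def (Ph^T *m Ph) -> pos_def A ->
  c * ln (\det (Ph^T *m Ph)) +
    \tr (invmx (Ph^T *m Ph) *m residual_moment (Gam_opt Mh)) <=
  c * ln (\det A) + \tr (invmx A *m residual_moment G).
Proof.
move=> Ph c0 Su; set B := Ph^T *m Ph => Bpd Apd.
have BE : residual_moment (Gam_opt Mh) = c *: B.
  rewrite /B /Ph Pi_half_residual trmx_scale -scalemxAl -scalemxAr !scalerA.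
  rewrite -mulrA -invfM -expr2 sqr_sqrtr ?ltW// divff ?gt_eqF// scale1r trmx_mul trmxK.
  by rewrite /residual_moment !mulmxA.
rewrite (residual_moment_Gam_opt G Su) mulmxDr mxtraceD BE -!scalemxAr.
rewrite !mxtraceZ mulVmx ?pos_def_unit// mxtrace1.
have := ln_det_mxtrace_min Apd Bpd.
have [L Lu LE] := cholesky Apd.
set D := G - _.
(* [Sigma Mh] is a Gram matrix, so by cyclicity this is the trace of [Y *m Y^T] with
   [Y = L^-1 D T1 Mh^T]. *)
have : 0 <= \tr (invmx A *m (D *m Sigma Mh *m D^T)).
  have -> : invmx A = (invmx L)^T *m invmx L.
    apply: invmx_unique; rewrite -LE mulmxA trmx_inv mulmxK ?unitmx_tr//.
    exact: mulmxV.
  rewrite -mulmxA mxtrace_mulC.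
  have -> : invmx L *m (D *m Sigma Mh *m D^T) *m (invmx L)^T =
    (invmx L *m D *m @T1 R nx nu ny *m Mh^T) *m
    (invmx L *m D *m @T1 R nx nu ny *m Mh^T)^T.
    by rewrite !trmx_mul trmxK /Sigma !mulmxA.
  exact: mxtrace_mul_tr_ge0.
move=> h1 h2; have := ler_wpM2l (ltW c0) h2; rewrite !mulrDr; lra.
Qed.

End regression.

(** * Gaussian densities *)

Section tuple_integral.
Context d (T : measurableType d) (R : realType).
Variable mu : {sigma_finite_measure set T -> \bar R}.

Lemma integral_tuple_cons n (F : n.+1.-tuple T -> \bar R) :
  measurable_fun [set: n.+1.-tuple T] F -> (forall x, (0 <= F x)%E) ->
  (\int[tuple_measure mu n.+1]_x F x =
   \int[mu]_a \int[tuple_measure mu n]_t F [tuple of a :: t])%E.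
Proof.
move=> mF F0.
rewrite [LHS](ge0_integral_pushforward (@measurable_consT _ T n))//.
rewrite preimage_setT fubini_tonelli1//=.
exact: measurableT_comp.
Qed.

Lemma measurable_integral_tuple_cons n (F : n.+1.-tuple T -> \bar R) :
  measurable_fun [set: n.+1.-tuple T] F -> (forall x, (0 <= F x)%E) ->
  measurable_fun [set: T]
    (fun a => \int[tuple_measure mu n]_t F [tuple of a :: t])%E.
Proof.
move=> mF F0.
have mFc : measurable_fun [set: T * n.-tuple T] (F \o @consT _ T n).
  exact: measurableT_comp.
exact: (@measurable_fun_fubini_tonelli_F _ _ _ _ _ (tuple_measure mu n) _ mFc (fun=> F0 _)).
Qed.

Lemma integral_tuple_nil (F : 0.-tuple T -> \bar R) :
  measurable_fun [set: 0.-tuple T] F ->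
  (\int[tuple_measure mu 0]_x F x = F [tuple])%E.
Proof.
by move=> mF; rewrite integral_dirac// diracT mul1e.
Qed.

End tuple_integral.

Section gaussian.
Context {R : realType}.

Lemma gauss_pdf_gt0 n (mu : 'cV[R]_n) P x : pos_def P -> 0 < gauss_pdf mu P x.
Proof.
move=> Ppd; rewrite mulr_gt0 ?expR_gt0// invr_gt0 sqrtr_gt0 mulr_gt0//.
  by rewrite exprn_gt0// mulr_gt0// pi_gt0.
exact: det_pos_def.
Qed.

Lemma gauss_pdf_ge0 n (mu : 'cV[R]_n) P x : 0 <= gauss_pdf mu P x.
Proof. by rewrite mulr_ge0 ?expR_ge0// invr_ge0 sqrtr_ge0. Qed.

Lemma ln_gauss_pdf n (mu : 'cV[R]_n) P x : pos_def P ->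
  ln (gauss_pdf mu P x) =
  - (ln ((2 * pi) ^+ n * \det P) + qform (invmx P) (x - mu)) / 2.
Proof.
move=> Ppd.
have d0 : 0 < (2 * pi) ^+ n * \det P.
  by rewrite mulr_gt0 ?det_pos_def// exprn_gt0// mulr_gt0// pi_gt0.
rewrite /gauss_pdf -/(qform _ _); set D := (2 * pi) ^+ n * _ in d0 *.
rewrite lnM ?posrE ?expR_gt0 ?invr_gt0 ?sqrtr_gt0//.
rewrite expRK lnV ?posrE ?sqrtr_gt0//.
have : ln D = ln (Num.sqrt D) *+ 2.
  by rewrite -lnXn ?sqrtr_gt0// sqr_sqrtr// ltW.
by move=> ->; rewrite mulr2n; field.
Qed.

Lemma gauss_pdf_le n (mu : 'cV[R]_n) P x : pos_def P ->
  gauss_pdf mu P x <= (Num.sqrt ((2 * pi) ^+ n * \det P))^-1.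
Proof.
move=> Ppd; rewrite ler_piMr ?invr_ge0 ?sqrtr_ge0// -expR0 ler_expR.
rewrite mulNr oppr_le0 divr_ge0//; exact/pos_def_qform_ge0/pos_def_inv.
Qed.

(** Marginal density times conditional density: the exponents split by [qform_inv_schur] and the
    normalising constants by [det_schur]. *)
Lemma gauss_pdf_block a b (mu : 'cV[R]_(a + b)) P x1 x2 : pos_def P ->
  gauss_pdf mu P (col_mx x1 x2) =
  gauss_pdf (usubmx mu) (ulsubmx P) x1 *
  gauss_pdf (dsubmx mu + dlsubmx P *m invmx (ulsubmx P) *m (x1 - usubmx mu))
    (schur P) x2.
Proof.
move=> Ppd; rewrite /gauss_pdf -!/(qform _ _) mulrACA -expRD -mulrDl -opprD.
have -> : col_mx x1 x2 - mu = col_mx (x1 - usubmx mu) (x2 - dsubmx mu).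
  by rewrite -[mu in LHS]vsubmxK opp_col_mx add_col_mx.
rewrite [X in qform (invmx (schur P)) X](_ : _ = x2 - dsubmx mu -
  dlsubmx P *m invmx (ulsubmx P) *m (x1 - usubmx mu)); last by rewrite opprD addrA.
rewrite -qform_inv_schur//; congr (_ * _).
rewrite -invfM -sqrtrM; last first.
  rewrite mulr_ge0 ?ltW ?det_pos_def ?exprn_gt0 ?mulr_gt0 ?pi_gt0//.
  exact: pos_def_ul.
by rewrite mulrACA -exprD -det_schur.
Qed.

Lemma gauss_pdf1 (mu : 'cV[R]_1) P (a : R) : pos_def P ->
  gauss_pdf mu P (const_mx a) = normal_pdf (mu 0 0) (Num.sqrt (P 0 0)) a.
Proof.
move=> Ppd; have p0 : 0 < P 0 0 by have := det_pos_def Ppd; rewrite det_mx11.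
rewrite normal_pdfE ?gt_eqF ?sqrtr_gt0// /normal_peak /normal_fun.
rewrite /gauss_pdf sqr_sqrtr ?ltW// det_mx11 expr1; congr ((Num.sqrt _)^-1 * expR _).
  by rewrite -mulr_natr; ring.
have -> : invmx P = ((P 0 0)^-1)%:M.
  apply: invmx_unique; rewrite {1}[P]mx11_scalar -scalar_mxM mulfV//.
  by rewrite gt_eqF.
rewrite -/(qform _ _) qform_sum !big_ord1 !mxE/= mulr1n -mulr_natr.
by field; rewrite gt_eqF.
Qed.

Lemma gauss_pdf0 (mu : 'cV[R]_0) P x : gauss_pdf mu P x = 1.
Proof.
rewrite /gauss_pdf -/(qform _ _) qform_sum big_ord0 oppr0 mul0r expR0 mulr1.
by rewrite expr0 mul1r det_mx00 sqrtr1 invr1.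
Qed.

Lemma vec_cons n (a : R) (t : n.-tuple (measurableTypeR R)) :
  vec [tuple of (a : measurableTypeR R) :: t] =
  col_mx (const_mx a : 'cV[R]_1) (vec t) :> 'cV[R]_(1 + n).
Proof.
apply/matrixP => i j; rewrite mxE -(splitK (i : 'I_(1 + n))).
case: splitP => k ik /=.
  by rewrite [RHS]col_mxEu mxE ord1.
by rewrite [RHS]col_mxEd mxE !(tnth_nth 0)/=.
Qed.

Definition measurable_vec d (T : measurableType d) n (f : T -> 'cV[R]_n) : Prop :=
  forall i, measurable_fun [set: T] (fun t => f t i 0).

Lemma measurable_gauss_pdf d (T : measurableType d) n P (mu f : T -> 'cV[R]_n) :
  measurable_vec mu -> measurable_vec f ->
  measurable_fun [set: T] (fun t => gauss_pdf (mu t) P (f t)).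
Proof.
move=> mmu mf; apply: measurable_funM; first exact: measurable_cst.
apply: measurableT_comp; first exact: measurable_expR.
apply: measurable_funM; last exact: measurable_cst.
apply: measurableT_comp; first exact: oppr_measurable.
under eq_fun do rewrite -/(qform _ _) qform_sum.
apply: measurable_sum => i; apply: measurable_sum => j.
apply: measurable_funM; first exact: measurable_cst.
by apply: measurable_funM; under eq_fun do rewrite !mxE; apply: measurable_funB.
Qed.

Lemma measurable_vec_vec d (T : measurableType d) n
    (f : T -> n.-tuple (measurableTypeR R)) :
  measurable_fun [set: T] f -> measurable_vec (fun t => vec (f t)).
Proof.
move=> mf i; under eq_fun do rewrite mxE.
by have /measurable_fun_tnthP := mf; exact.
Qed.

Lemma measurable_vec_cst d (T : measurableType d) n (c : 'cV[R]_n) :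
  measurable_vec (fun _ : T => c).
Proof. by move=> i; exact: measurable_cst. Qed.

Lemma measurable_vec_col d (T : measurableType d) n p (f : T -> 'cV[R]_n)
    (g : T -> 'cV[R]_p) : measurable_vec f -> measurable_vec g ->
  measurable_vec (fun t => col_mx (f t) (g t)).
Proof.
move=> mf mg i; rewrite -(splitK i); case: splitP => k _ /=.
  by under eq_fun do rewrite col_mxEu; exact: mf.
by under eq_fun do rewrite col_mxEd; exact: mg.
Qed.

Lemma measurable_vec_mulmx d (T : measurableType d) n p (A : 'M[R]_(p, n))
    (f : T -> 'cV[R]_n) : measurable_vec f -> measurable_vec (fun t => A *m f t).
Proof.
move=> mf i; under eq_fun do rewrite mxE.
by apply: measurable_sum => j; apply: measurable_funM => //; exact: measurable_cst.
Qed.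

Lemma integral_gauss_pdf1 (mu : 'cV[R]_1) P : pos_def P ->
  (\int[@lebesgue_measure R]_a (gauss_pdf mu P (const_mx a))%:E = 1)%E.
Proof.
move=> Ppd; under eq_integral do rewrite gauss_pdf1//.
exact: integral_normal_pdf.
Qed.

(** The first coordinate is split off with [gauss_pdf_block]: the conditional factor integrates to 1
    by induction, which leaves a one-dimensional normal density. *)
Lemma integral_gauss_pdf n (mu : 'cV[R]_n) P : pos_def P ->
  (\int[leb n]_x (gauss_pdf mu P (vec x))%:E = 1)%E.
Proof.
elim: n mu P => [|n IH] mu P Ppd.
  rewrite /leb integral_tuple_nil ?gauss_pdf0//.
  by under eq_fun do rewrite gauss_pdf0; exact: measurable_cst.
rewrite /leb integral_tuple_cons; last 2 first.
- apply/measurable_EFinP; apply: measurable_gauss_pdf.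
    exact: measurable_vec_cst.
  by apply: measurable_vec_vec; exact: measurable_id.
- by move=> x; rewrite lee_fin gauss_pdf_ge0.
rewrite -[RHS](integral_gauss_pdf1 (usubmx (mu : 'cV[R]_(1 + n)))
  (@pos_def_ul _ 1 n P Ppd)).
apply: eq_integral => a _.
under eq_integral do rewrite vec_cons (@gauss_pdf_block 1 n)// EFinM.
rewrite ge0_integralZl//=; last 3 first.
- apply/measurable_EFinP; apply: measurable_gauss_pdf.
    exact: measurable_vec_cst.
  by apply: measurable_vec_vec; exact: measurable_id.
- by move=> x _; rewrite lee_fin gauss_pdf_ge0.
- by rewrite lee_fin gauss_pdf_ge0.
by rewrite IH ?mule1//; exact: (@pos_def_schur _ 1 n).
Qed.

Lemma integral_gauss_pdf_dsub a b (mu : 'cV[R]_(a + b)) P x1 : pos_def P ->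
  (\int[leb b]_x2 (gauss_pdf mu P (col_mx x1 (vec x2)))%:E =
   (gauss_pdf (usubmx mu) (ulsubmx P) x1)%:E)%E.
Proof.
move=> Ppd; under eq_integral do rewrite gauss_pdf_block// EFinM.
rewrite ge0_integralZl//=; last 3 first.
- apply/measurable_EFinP; apply: measurable_gauss_pdf.
    exact: measurable_vec_cst.
  by apply: measurable_vec_vec; exact: measurable_id.
- by move=> x _; rewrite lee_fin gauss_pdf_ge0.
- by rewrite lee_fin gauss_pdf_ge0.
by rewrite integral_gauss_pdf ?mule1//; exact: pos_def_schur.
Qed.

Lemma integral_gauss_pdf_pair a b (mu : 'cV[R]_(a + b)) P : pos_def P ->
  (\int[leb a \x leb b]_xx
    (gauss_pdf mu P (col_mx (vec xx.1) (vec xx.2)))%:E = 1)%E.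
Proof.
move=> Ppd; rewrite fubini_tonelli1/=; last 2 first.
- apply/measurable_EFinP; apply: measurable_gauss_pdf.
    exact: measurable_vec_cst.
  by apply: measurable_vec_col; apply: measurable_vec_vec;
    [exact: measurable_fst|exact: measurable_snd].
- by move=> x; rewrite lee_fin gauss_pdf_ge0.
rewrite /fubini_F /=; under eq_integral do rewrite integral_gauss_pdf_dsub//.
exact/integral_gauss_pdf/pos_def_ul.
Qed.

Lemma integrable_gauss_pdf_pair a b (mu : 'cV[R]_(a + b)) P : pos_def P ->
  (leb a \x leb b)%E.-integrable
    [set: a.-tuple (measurableTypeR R) * b.-tuple (measurableTypeR R)]
    (EFin \o (fun xx => gauss_pdf mu P (col_mx (vec xx.1) (vec xx.2)))).
Proof.
move=> Ppd; apply/integrableP; split.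
  apply/measurable_EFinP; apply: measurable_gauss_pdf.
    exact: measurable_vec_cst.
  by apply: measurable_vec_col; apply: measurable_vec_vec;
    [exact: measurable_fst|exact: measurable_snd].
under eq_integral do rewrite /= ger0_norm ?gauss_pdf_ge0//.
by rewrite integral_gauss_pdf_pair// ltry.
Qed.

(* q e^(-q/2) <= 4 e^(-q/4), whose right-hand side is a multiple of the
   Gaussian density with covariance 2 P. *)
Lemma sqr_gauss_pdf_le n (mu : 'cV[R]_n) P i : pos_def P ->
  exists2 K : R, 0 <= K & forall x : 'cV[R]_n,
    (x i 0 - mu i 0) ^+ 2 * gauss_pdf mu P x <= K * gauss_pdf mu (2 *: P) x.
Proof.
move=> Ppd; have P2pd : pos_def (2 *: P) by exact: pos_defZ.
have Pii : 0 <= P i i.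
  have := pos_def_qform_ge0 (delta_mx i 0) Ppd.
  by rewrite /qform trmx_delta -rowE -colE !mxE.
have sqrt0 (Q : 'M[R]_n) : pos_def Q -> 0 < Num.sqrt ((2 * pi) ^+ n * \det Q).
  move=> Qpd; rewrite sqrtr_gt0 mulr_gt0 ?det_pos_def// exprn_gt0// mulr_gt0//.
  exact: pi_gt0.
pose c1 := Num.sqrt ((2 * pi) ^+ n * \det P).
pose c2 := Num.sqrt ((2 * pi) ^+ n * \det (2 *: P)).
have c10 : 0 < c1 by exact: sqrt0.
have c20 : 0 < c2 by exact: sqrt0.
(* [P i i] comes from [sqr_coord_le_qform_inv], [c2 / c1] exchanges the normalising constants, and 4
   bounds [q * expR (- q / 4)], by [t <= expR t] at [t = q / 4]. *)
exists (4 * P i i * c2 / c1).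
  by rewrite divr_ge0 ?mulr_ge0 ?(ltW c10) ?(ltW c20).
move=> x; rewrite /gauss_pdf -!/(qform _ _) -/c1 -/c2.
have -> : qform (invmx (2 *: P)) (x - mu) = qform (invmx P) (x - mu) / 2.
  have -> : invmx (2 *: P) = 2^-1 *: invmx P.
    apply: invmx_unique; rewrite -scalemxAl -scalemxAr scalerA divff//.
    by rewrite scale1r mulmxV// pos_def_unit.
  by rewrite /qform -scalemxAr -scalemxAl mxE mulrC.
have := sqr_coord_le_qform_inv (x - mu) i Ppd.
have : 0 <= qform (invmx P) (x - mu) by exact/pos_def_qform_ge0/pos_def_inv.
set q := qform _ _; rewrite !mxE => q0 xq.
have -> : - q / 2 = - (q / 2) / 2 + - (q / 2) / 2 by field.
rewrite expRD; set e := expR _; have e0 : 0 < e by exact: expR_gt0.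
have qe : q * e <= 4.
  have : q / 4 <= expR (q / 4).
    by apply: le_trans (expR_ge1Dx _); rewrite lerDr.
  have -> : expR (q / 4) = e^-1 by rewrite -expRN; congr expR; field.
  by rewrite -(ler_pM2r e0) mulVf ?gt_eqF//; lra.
have -> : (x i 0 - mu i 0) ^+ 2 * (c1^-1 * (e * e)) =
  (x i 0 - mu i 0) ^+ 2 * e * (e / c1) by ring.
have -> : 4 * P i i * c2 / c1 * (c2^-1 * e) = P i i * 4 * (e / c1).
  by field; rewrite !gt_eqF.
apply: ler_wpM2r; first by rewrite divr_ge0 ?ltW.
apply: (le_trans (ler_wpM2r (ltW e0) xq)).
by rewrite -mulrA ler_wpM2l.
Qed.

End gaussian.

(** * Square integrability with respect to a density *)

Section square_integrable.
Context d (T : measurableType d) (R : realType).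
Variables (nu : {measure set T -> \bar R}) (rho : T -> R).
Hypothesis mrho : measurable_fun [set: T] rho.
Hypothesis rho0 : forall x, 0 <= rho x.

Definition sq_integrable (f : T -> R) : Prop :=
  measurable_fun [set: T] f /\
  nu.-integrable [set: T] (EFin \o (fun x => f x ^+ 2 * rho x)).

(** The product is dominated by [f ^+ 2 + g ^+ 2]. This reduces second moments of the stacked vector
    to squares of single coordinates. *)
Lemma sq_integrable_mul f g : sq_integrable f -> sq_integrable g ->
  nu.-integrable [set: T] (EFin \o (fun x => f x * g x * rho x)).
Proof.
move=> [mf If] [mg Ig].
apply: (le_integrable measurableT _ _ (integrableD measurableT If Ig)).
  by apply/measurable_EFinP; do 2 apply: measurable_funM => //.
move=> x _ /=; rewrite lee_fin.
rewrite -mulrDl [leLHS]normrM [leRHS]normrM (ger0_norm (rho0 x)).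
apply: ler_wpM2r => //; rewrite [leRHS]ger0_norm ?addr_ge0 ?sqr_ge0// normrM.
rewrite -[f x ^+ 2]real_normK ?num_real// -[g x ^+ 2]real_normK ?num_real//.
have := sqr_ge0 (`|f x| - `|g x|).
have := normr_ge0 (f x); have := normr_ge0 (g x); nra.
Qed.

Lemma sq_integrable_cst c : nu.-integrable [set: T] (EFin \o rho) ->
  sq_integrable (fun=> c).
Proof.
move=> Irho; split; first exact: measurable_cst.
have := integrableZl measurableT (c ^+ 2) Irho.
by apply: eq_integrable => // x _ /=; rewrite EFinM.
Qed.

Lemma sq_integrableD f g : sq_integrable f -> sq_integrable g ->
  sq_integrable (fun x => f x + g x).
Proof.
move=> [mf If] [mg Ig]; split; first exact: measurable_funD.
apply: (le_integrable measurableT _ _ (integrableZl measurableT 2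
  (integrableD measurableT If Ig))).
  by apply/measurable_EFinP; apply: measurable_funM => //; apply: measurable_funX;
    exact: measurable_funD.
move=> x _ /=; rewrite lee_fin.
rewrite -mulrDl mulrA !ger0_norm.
- apply: ler_wpM2r => //; by have := sqr_ge0 (f x - g x); nra.
- by rewrite !mulr_ge0 ?addr_ge0 ?sqr_ge0.
- by apply: mulr_ge0 => //; exact: sqr_ge0.
Qed.

End square_integrable.

(** * Singling out two adjacent coordinates of a tuple *)

Section insert_pair.
Context d (T : measurableType d) (R : realType).
Variable mu : {sigma_finite_measure set T -> \bar R}.

(** Naming the product lets it carry a sigma-finite structure, which exchanging the integral of one
    coordinate with that of a pair requires. *)
Definition square_measure : set (T * T) -> \bar R := (mu \x mu)%E.

HB.instance Definition _ := Measure.on square_measure.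

Lemma square_measure_sigma_finite : sigma_finite setT square_measure.
Proof.
have /sigma_finiteP[F [TF ndF Foo]] := sigma_finiteT mu.
exists (fun k => F k `*` F k).
  apply/seteqP; split=> // -[x y] _.
  have [i _ Fi] : (\bigcup_i F i) x by rewrite -TF.
  have [j _ Fj] : (\bigcup_i F i) y by rewrite -TF.
  exists (maxn i j) => //; split.
    by move: Fi; apply/subsetPset/ndF/leq_maxl.
  by move: Fj; apply/subsetPset/ndF/leq_maxr.
move=> k; have [mF Fk] := Foo k; split; first exact: measurableX.
by rewrite /square_measure product_measure1E// lte_mul_pinfty// ge0_fin_numE.
Qed.

HB.instance Definition _ :=
  Measure_isSigmaFinite.Build _ _ _ square_measure square_measure_sigma_finite.

Lemma fubini_tonelli_square (f : T * (T * T) -> \bar R) :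
  measurable_fun [set: T * (T * T)] f -> (forall x, (0 <= f x)%E) ->
  (\int[mu]_x \int[mu \x mu]_y f (x, y))%E = (\int[mu \x mu]_y \int[mu]_x f (x, y))%E.
Proof.
move=> mf f0.
exact: (@fubini_tonelli _ _ _ _ _ mu square_measure f mf f0).
Qed.

(** This is [insert_pair] for [N = n.+1], with length and position freed so that both can vary in an
    induction. *)
Definition insert_pair_at n (k : nat) (a b : T) (t : n.-tuple T) : n.+2.-tuple T :=
  [tuple nth a (take k t ++ a :: b :: drop k t) i | i < n.+2].

Lemma val_insert_pair_at n k a b (t : n.-tuple T) : (k <= n)%N ->
  insert_pair_at k a b t = take k t ++ a :: b :: drop k t :> seq T.
Proof.
move=> kn.
have sz : size (take k t ++ a :: b :: drop k t) = n.+2.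
  rewrite size_cat size_take /= size_drop size_tuple.
  by case: ltngtP kn => // kn _; lia.
apply: (@eq_from_nth _ a) => [|i]; first by rewrite size_tuple sz.
rewrite size_tuple => ilt.
by rewrite -[i]/(nat_of_ord (Ordinal ilt)) -tnth_nth tnth_mktuple.
Qed.

Lemma insert_pair_at0 n a b (t : n.-tuple T) :
  insert_pair_at 0 a b t = [tuple of a :: [tuple of b :: t]].
Proof.
by apply: val_inj; rewrite [LHS]val_insert_pair_at//= take0 drop0.
Qed.

Lemma insert_pair_atS n k a b c (t : n.-tuple T) : (k <= n)%N ->
  insert_pair_at k.+1 a b [tuple of c :: t] = [tuple of c :: insert_pair_at k a b t].
Proof.
move=> kn; apply: val_inj.
by rewrite [LHS]val_insert_pair_at//= val_insert_pair_at.
Qed.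

Lemma measurable_insert_pair_at n k : (k <= n)%N ->
  measurable_fun [set: (T * T) * n.-tuple T]
    (fun x => insert_pair_at k x.1.1 x.1.2 x.2).
Proof.
move=> kn; apply/measurable_fun_tnthP => i.
rewrite [X in measurable_fun _ X](_ : _ = fun x : T * T * n.-tuple T =>
    nth x.1.1 (take k x.2 ++ x.1.1 :: x.1.2 :: drop k x.2) i); last first.
  by apply/funext => x /=; rewrite tnth_mktuple.
have szt (t : n.-tuple T) : size (take k t) = k.
  by rewrite size_take size_tuple; case: ltngtP kn.
have m1 : measurable_fun [set: T * T * n.-tuple T] (fun x => x.1.1).
  by apply: measurableT_comp; [exact: measurable_fst|exact: measurable_fst].
have m2 : measurable_fun [set: T * T * n.-tuple T] (fun x => x.1.2).
  by apply: measurableT_comp; [exact: measurable_snd|exact: measurable_fst].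
have mt (j : 'I_n) : measurable_fun [set: T * T * n.-tuple T] (fun x => tnth x.2 j).
  by apply: (measurableT_comp (measurable_tnth j)); exact: measurable_snd.
under eq_fun do rewrite nth_cat szt.
case: ltnP => [ik|ki].
  have iN : (i < n)%N by exact: leq_trans kn.
  apply: eq_measurable_fun (mt (Ordinal iN)) => x _ /=.
  by rewrite nth_take// (tnth_nth x.1.1).
(* Offsets 0 and 1 past [k] are the inserted pair; offset [j.+2] is coordinate [k + j] of the
   original tuple. *)
case E : (i - k)%N => [|[|j]] //=.
have jn : (k + j < n)%N by have := ltn_ord i; lia.
apply: eq_measurable_fun (mt (Ordinal jn)) => x _ /=.
by rewrite nth_drop (tnth_nth x.1.1).
Qed.

Lemma integral_insert_pair_at0 n (F : n.+2.-tuple T -> \bar R) :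
  measurable_fun [set: n.+2.-tuple T] F -> (forall x, (0 <= F x)%E) ->
  (\int[tuple_measure mu n.+2]_x F x =
   \int[mu \x mu]_ab \int[tuple_measure mu n]_t
     F (insert_pair_at 0 ab.1 ab.2 t))%E.
Proof.
move=> mF F0.
have mI : measurable_fun [set: T * T * n.-tuple T]
    (fun x => F (insert_pair_at 0 x.1.1 x.1.2 x.2)).
  by apply: (measurableT_comp mF); exact: measurable_insert_pair_at.
have mJ := measurable_fun_fubini_tonelli_F (m2 := tuple_measure mu n) _ mI (fun=> F0 _).
have J0 (x : T * T) : (0 <= fubini_F (tuple_measure mu n)
    (fun x => F (insert_pair_at 0 x.1.1 x.1.2 x.2)) x)%E.
  by apply: integral_ge0.
rewrite [RHS](fubini_tonelli1 _ mJ J0) integral_tuple_cons//.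
apply: eq_integral => a _.
rewrite (@integral_tuple_cons _ _ _ mu n (fun s => F [tuple of a :: s])).
- apply: eq_integral => b _; apply: eq_integral => t _.
  by rewrite insert_pair_at0.
- apply: (measurableT_comp mF).
  exact: (measurable_fun_pair2 a (@measurable_consT _ T n.+1)).
- by move=> s.
Qed.

(** Induction on the position: the head coordinate is peeled off, the pair is pulled out of the
    shorter tuple, and Tonelli moves the integral over the pair outside. *)
Lemma integral_insert_pair_at n k (F : n.+2.-tuple T -> \bar R) : (k <= n)%N ->
  measurable_fun [set: n.+2.-tuple T] F -> (forall x, (0 <= F x)%E) ->
  (\int[tuple_measure mu n.+2]_x F x =
   \int[mu \x mu]_ab \int[tuple_measure mu n]_t
     F (insert_pair_at k ab.1 ab.2 t))%E.
Proof.
elim: n k F => [|n IH] k F kn mF F0.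
  move: kn; rewrite leqn0 => /eqP ->; exact: integral_insert_pair_at0.
case: k kn => [|k] kn; first exact: integral_insert_pair_at0.
rewrite ltnS in kn.
have mFc : measurable_fun [set: T * n.+2.-tuple T] (F \o @consT _ T n.+2).
  exact: measurableT_comp.
have mI : measurable_fun [set: T * (T * T) * n.-tuple T]
    (fun x => F [tuple of x.1.1 :: insert_pair_at k x.1.2.1 x.1.2.2 x.2]).
  apply: (measurableT_comp mFc (g := fun x : T * (T * T) * n.-tuple T =>
    (x.1.1, insert_pair_at k x.1.2.1 x.1.2.2 x.2))).
  apply: measurable_fun_pair.
    by apply: measurableT_comp; [exact: measurable_fst|exact: measurable_fst].
  apply: (measurableT_comp (measurable_insert_pair_at kn)
    (g := fun x : T * (T * T) * n.-tuple T => (x.1.2, x.2))).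
  apply: measurable_fun_pair; last exact: measurable_snd.
  by apply: measurableT_comp; [exact: measurable_snd|exact: measurable_fst].
rewrite integral_tuple_cons//.
under eq_integral => c _.
  rewrite (IH k (fun s => F [tuple of c :: s]))//; last first.
    apply: (measurableT_comp mFc (g := fun x => (c, x))).
    exact: pair1_measurable.
  over.
have mJ := measurable_fun_fubini_tonelli_F (m2 := tuple_measure mu n) _ mI (fun=> F0 _).
have J0 (x : T * (T * T)) : (0 <= fubini_F (tuple_measure mu n)
    (fun x => F [tuple of x.1.1 :: insert_pair_at k x.1.2.1 x.1.2.2 x.2]) x)%E.
  by apply: integral_ge0.
rewrite [LHS](fubini_tonelli_square mJ J0).
apply: eq_integral => ab _.
rewrite (@integral_tuple_cons _ _ _ mu n (fun t => F (insert_pair_at k.+1 ab.1 ab.2 t))).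
- apply: eq_integral => c _; apply: eq_integral => t _.
  by rewrite insert_pair_atS.
- apply: (measurableT_comp mF).
  exact: (measurable_fun_pair2 ab (@measurable_insert_pair_at n.+1 k.+1 kn)).
- by move=> s.
Qed.

End insert_pair.

(** * Marginals of the smoothed law *)

Section trajectories.
Context {R : realType} {nx N : nat}.
Local Notation state := (nx.-tuple (measurableTypeR R)).

Lemma tnth_insert_pair_now (k : 'I_N) (a b : state) (t : N.-1.-tuple state) :
  tnth (insert_pair k a b t) (now k) = a.
Proof.
have kN := ltn_ord k.
rewrite tnth_mktuple /= nth_cat size_take size_tuple.
have -> : (if (k < N.-1)%N then k : nat else N.-1) = k by case: ltnP => //; lia.
by rewrite ltnn subnn.
Qed.

Lemma tnth_insert_pair_next (k : 'I_N) (a b : state) (t : N.-1.-tuple state) :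
  tnth (insert_pair k a b t) (Defs.next k) = b.
Proof.
have kN := ltn_ord k.
rewrite tnth_mktuple /= nth_cat size_take size_tuple /bump leq0n.
have -> : (if (k < N.-1)%N then k : nat else N.-1) = k by case: ltnP => //; lia.
by rewrite add1n ltnNge leqnSn /= subSnn.
Qed.

End trajectories.

Lemma integral_insert_pair (R : realType) (nx N : nat) (k : 'I_N)
    (F : N.+1.-tuple (nx.-tuple (measurableTypeR R)) -> \bar R) :
  measurable_fun [set: N.+1.-tuple (nx.-tuple (measurableTypeR R))] F ->
  (forall x, (0 <= F x)%E) ->
  (\int[leb_traj nx N.+1]_x F x =
   \int[leb_pair nx]_ab \int[leb_traj nx N.-1]_t F (insert_pair k ab.1 ab.2 t))%E.
Proof.
case: N k F => [[]//|n] k F mF F0.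
exact: (integral_insert_pair_at (leb nx) (ltn_ord k : (k <= n)%N) mF F0).
Qed.

Lemma measurable_insert_pair (R : realType) (nx N : nat) (k : 'I_N) :
  measurable_fun [set: (nx.-tuple (measurableTypeR R) * nx.-tuple (measurableTypeR R)) *
    N.-1.-tuple (nx.-tuple (measurableTypeR R))]
  (fun x => insert_pair k x.1.1 x.1.2 x.2).
Proof.
case: N k => [[]//|n] k.
exact: (@measurable_insert_pair_at _ _ n k (ltn_ord k : (k <= n)%N)).
Qed.

Lemma measurable_lne d (T : measurableType d) (R : realType) (f : T -> R) :
  measurable_fun [set: T] f -> measurable_fun [set: T] (fun x => lne (f x)%:E).
Proof.
move=> mf.
rewrite [X in measurable_fun _ X](_ : _ =
    fun x => if 0 < f x then (ln (f x))%:E else -oo%E); last first.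
  apply/funext => x; case: ifPn => [f0|]; first exact: lne_EFin.
  by rewrite -leNgt => f0; exact: le0_lneNy.
apply: measurable_fun_ifT; first exact: measurable_fun_ltr.
  by apply/measurable_EFinP; apply: measurableT_comp => //; exact: measurable_ln.
exact: measurable_cst.
Qed.

(** * Joint and smoothed densities of one parameter *)

Section param.
Context {R : realType} {m nx nu ny N : nat}.
Variables (u : 'I_N -> 'cV[R]_nu) (y : 'I_N -> 'cV[R]_ny).
Variable th : @param R m nx nu ny.
Hypothesis th_param : is_param th.
Local Notation state := (nx.-tuple (measurableTypeR R)).
Local Notation traj n := (n.-tuple state).
Local Notation modes := (N.+1.-tuple 'I_m).
Local Notation s := (smoothed_pdf u y th).

Lemma measurable_state (k : 'I_N.+1) :
  measurable_vec (fun x : traj N.+1 => vec (tnth x k)).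
Proof. by apply: measurable_vec_vec; exact: measurable_tnth. Qed.

Lemma measurable_gauss_factor z k :
  measurable_fun [set: traj N.+1] (fun x => gauss_factor u y th x z k).
Proof.
apply: measurable_gauss_pdf.
  apply: measurable_vec_mulmx; apply: measurable_vec_col.
    exact: measurable_state.
  exact: measurable_vec_cst.
apply: measurable_vec_col; first exact: measurable_vec_cst.
exact: measurable_state.
Qed.

Lemma measurable_joint_pdf z :
  measurable_fun [set: traj N.+1] (fun x => joint_pdf u y th x z).
Proof.
case: th_param => -[mi _ _] _ _.
apply: measurable_funM.
  by apply: (measurableT_comp (mi _)); exact: measurable_tnth.
apply: measurable_prod => k _.
apply: measurable_funM; first exact: measurable_gauss_factor.
exact: measurable_cst.
Qed.

Lemma trans_prob_ge0 j i : 0 <= trans_prob th j i.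
Proof. by case: th_param => _ T0 _; rewrite divr_ge0 ?sumr_ge0. Qed.

Lemma joint_pdf_ge0 x z : 0 <= joint_pdf u y th x z.
Proof.
case: th_param => -[_ i0 _] T0 _; rewrite mulr_ge0//.
by apply: prodr_ge0 => k _; rewrite mulr_ge0 ?gauss_pdf_ge0 ?trans_prob_ge0.
Qed.

Lemma joint_pdf_gt0 x z : 0 < joint_pdf u y th x z ->
  0 < init_pdf th (tnth x ord0) (tnth z ord0) /\
  forall k, 0 < trans_prob th (tnth z (Defs.next k)) (tnth z (now k)).
Proof.
move=> j0; case: th_param => -[_ i0 _] _ _.
have : joint_pdf u y th x z != 0 by rewrite gt_eqF.
rewrite /joint_pdf mulf_eq0 negb_or => /andP[i_neq0 /prodf_neq0 p_neq0].
split; first by rewrite lt0r i_neq0 i0.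
move=> k; rewrite lt0r trans_prob_ge0 andbT.
by have := p_neq0 k isT; rewrite mulf_eq0 negb_or => /andP[].
Qed.

Lemma ln_joint_pdf x z : 0 < init_pdf th (tnth x ord0) (tnth z ord0) ->
  (forall k, 0 < trans_prob th (tnth z (Defs.next k)) (tnth z (now k))) ->
  lne (joint_pdf u y th x z)%:E =
  (ln (init_pdf th (tnth x ord0) (tnth z ord0)) +
   \sum_(k < N) (ln (gauss_factor u y th x z k) +
      ln (trans_prob th (tnth z (Defs.next k)) (tnth z (now k)))))%:E.
Proof.
move=> i0 t0; rewrite lne_joint_pdf// lne_EFin// EFinD -sumEFin; congr (_ + _)%E.
apply: eq_bigr => k _; rewrite EFinD !lne_EFin//.
by case: th_param => _ _ pd; exact: gauss_pdf_gt0.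
Qed.

Lemma evidence_ge0 : 0 <= evidence u y th.
Proof.
apply: fine_ge0; apply: sume_ge0 => z _; apply: integral_ge0 => x _.
by rewrite lee_fin joint_pdf_ge0.
Qed.

Lemma smoothed_pdf_ge0 x z : 0 <= s x z.
Proof. by rewrite divr_ge0 ?joint_pdf_ge0 ?evidence_ge0. Qed.

Lemma measurable_smoothed_pdf z : measurable_fun [set: traj N.+1] (fun x => s x z).
Proof. by apply: measurable_funM => //; exact: measurable_joint_pdf. Qed.

Lemma integral_joint_pdf_ge0 z :
  (0 <= \int[leb_traj nx N.+1]_x (joint_pdf u y th x z)%:E)%E.
Proof. by apply: integral_ge0 => x _; rewrite lee_fin joint_pdf_ge0. Qed.

(** [evidence] takes [fine], which would return 0 on an infinite sum; a nonzero evidence is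
    therefore the true total mass. *)
Lemma sum_integral_joint_pdf : evidence u y th != 0 ->
  (\sum_(z : modes) \int[leb_traj nx N.+1]_x (joint_pdf u y th x z)%:E =
   (evidence u y th)%:E)%E.
Proof.
rewrite /evidence; set S := (\sum_z _)%E => S0.
rewrite fineK//; have : (0 <= S)%E.
  by apply: sume_ge0 => z _; exact: integral_joint_pdf_ge0.
by move: S0; case: S => //; rewrite eqxx.
Qed.

Lemma integral_smoothed_pdfE z :
  (\int[leb_traj nx N.+1]_x (s x z)%:E = ((evidence u y th)^-1)%:E *
   \int[leb_traj nx N.+1]_x (joint_pdf u y th x z)%:E)%E.
Proof.
rewrite -ge0_integralZl_EFin//.
- by apply: eq_integral => x _; rewrite -EFinM mulrC.
- by move=> x _; rewrite lee_fin joint_pdf_ge0.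
- by apply/measurable_EFinP; exact: measurable_joint_pdf.
- by rewrite invr_ge0 evidence_ge0.
Qed.

Lemma sum_integral_smoothed_pdf : evidence u y th != 0 ->
  (\sum_(z : modes) \int[leb_traj nx N.+1]_x (s x z)%:E = 1)%E.
Proof.
move=> e0; under eq_bigr do rewrite integral_smoothed_pdfE.
rewrite -ge0_sume_distrr; last by move=> z _; exact: integral_joint_pdf_ge0.
by rewrite sum_integral_joint_pdf// -EFinM mulVf.
Qed.

Lemma integrable_smoothed_pdf z :
  (leb_traj nx N.+1).-integrable [set: traj N.+1] (EFin \o (s ^~ z)).
Proof.
apply/integrableP; split.
  by apply/measurable_EFinP; exact: measurable_smoothed_pdf.
under eq_integral do rewrite /= ger0_norm ?smoothed_pdf_ge0//.
rewrite integral_smoothed_pdfE.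
(* With zero evidence the convention [0^-1 = 0] makes the smoothed density identically 0, hence
   integrable. *)
have [->|e0] := eqVneq (evidence u y th) 0; first by rewrite invr0 mul0e.
rewrite lte_mul_pinfty ?lee_fin ?invr_ge0 ?evidence_ge0//.
apply: (@le_lt_trans _ _ (evidence u y th)%:E); last exact: ltry.
rewrite -sum_integral_joint_pdf// (bigD1 z)//= leeDl//.
by apply: sume_ge0 => *; exact: integral_joint_pdf_ge0.
Qed.

End param.

Lemma Rintegral_EFin d (T : measurableType d) (R : realType) (nu : {measure set T -> \bar R})
    (f : T -> R) : nu.-integrable [set: T] (EFin \o f) ->
  (\int[nu]_x f x)%:E = (\int[nu]_x (f x)%:E)%E.
Proof. by move=> If; rewrite fineK//; exact: (integrable_fin_num measurableT If). Qed.

Section Rintegral_sum.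
Context d (T : measurableType d) (R : realType) (nu : {measure set T -> \bar R}).

Lemma integrable_sumr (I : Type) (r : seq I) (F : I -> T -> R) :
  (forall i, nu.-integrable [set: T] (EFin \o F i)) ->
  nu.-integrable [set: T] (EFin \o (fun x => \sum_(i <- r) F i x)).
Proof.
move=> IF; have := integrable_sum measurableT r (P := xpredT) (fun i _ => IF i).
by apply: eq_integrable => // x _ /=; rewrite sumEFin.
Qed.

Lemma Rintegral_sum (I : Type) (r : seq I) (F : I -> T -> R) :
  (forall i, nu.-integrable [set: T] (EFin \o F i)) ->
  \int[nu]_x (\sum_(i <- r) F i x) = \sum_(i <- r) \int[nu]_x F i x.
Proof.
move=> IF; elim: r => [|i r IH].
  by rewrite big_nil; under eq_Rintegral do rewrite big_nil; rewrite Rintegral_cst// mul0r.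
rewrite big_cons -IH -RintegralD//; last exact: integrable_sumr.
by apply: eq_Rintegral => x _; rewrite big_cons.
Qed.

End Rintegral_sum.

(** * Smoothed expectations over a pair of consecutive times *)

Section mixture.
Context {R : realType} {m nx nu ny N : nat}.
Variables (u : 'I_N -> 'cV[R]_nu) (y : 'I_N -> 'cV[R]_ny).
Variable th : @param R m nx nu ny.
Variable MS : 'I_N -> nat.
Variable w : forall k : 'I_N, 'I_(MS k) -> 'I_m -> 'I_m -> R.
Variable mu : forall k : 'I_N, 'I_(MS k) -> 'I_m -> 'I_m -> 'cV[R]_(nx + nx).
Variable P : forall k : 'I_N, 'I_(MS k) -> 'I_m -> 'I_m -> 'M[R]_(nx + nx).
Arguments w {k} _ _ _.
Arguments mu {k} _ _ _.
Arguments P {k} _ _ _.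
Hypothesis th_param : is_param th.
Hypothesis mix : is_smoothed_mixture u y (@w) (@mu) (@P) th.
Local Notation state := (nx.-tuple (measurableTypeR R)).
Local Notation traj n := (n.-tuple state).
Local Notation modes := (N.+1.-tuple 'I_m).
Local Notation s := (smoothed_pdf u y th).

Definition component k (l : 'I_(MS k)) z z' (xx : state * state) : R :=
  gauss_pdf (mu l z z') (P l z z') (col_mx (vec xx.1) (vec xx.2)).

Lemma component_ge0 k (l : 'I_(MS k)) z z' xx : 0 <= component l z z' xx.
Proof. exact: gauss_pdf_ge0. Qed.

Lemma measurable_component k (l : 'I_(MS k)) z z' :
  measurable_fun [set: state * state] (component l z z').
Proof.
apply: measurable_gauss_pdf; first exact: measurable_vec_cst.
by apply: measurable_vec_col; apply: measurable_vec_vec;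
  [exact: measurable_fst|exact: measurable_snd].
Qed.

Lemma integral_component k (l : 'I_(MS k)) z z' :
  (\int[leb_pair nx]_xx (component l z z' xx)%:E = 1)%E.
Proof. by case: mix => _ Ppd _; exact: integral_gauss_pdf_pair. Qed.

Lemma integrable_component k (l : 'I_(MS k)) z z' :
  (leb_pair nx).-integrable [set: state * state] (EFin \o component l z z').
Proof.
by case: mix => _ Ppd _; exact: integrable_gauss_pdf_pair.
Qed.

Section pair_marginal.
Variables (k : 'I_N) (z z' : 'I_m).

Let others (zs : modes) (ab : state * state) : \bar R :=
  (\int[leb_traj nx N.-1]_t (s (insert_pair k ab.1 ab.2 t) zs)%:E)%E.

Let others_ge0 zs ab : (0 <= others zs ab)%E.
Proof. by apply: integral_ge0 => t _; rewrite lee_fin smoothed_pdf_ge0. Qed.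

Let measurable_s_insert zs :
  measurable_fun [set: (state * state) * N.-1.-tuple state]
    (fun x => (s (insert_pair k x.1.1 x.1.2 x.2) zs)%:E).
Proof.
apply/measurable_EFinP.
apply: (measurableT_comp (measurable_smoothed_pdf u y th_param zs)).
exact: measurable_insert_pair.
Qed.

Let measurable_others zs : measurable_fun [set: state * state] (others zs).
Proof.
apply: (measurable_fun_fubini_tonelli_F (m2 := leb_traj nx N.-1) _
  (measurable_s_insert zs)) => x.
by rewrite lee_fin smoothed_pdf_ge0.
Qed.

Let integral_others zs :
  (\int[leb_pair nx]_ab others zs ab = \int[leb_traj nx N.+1]_x (s x zs)%:E)%E.
Proof.
rewrite (integral_insert_pair k)//.
  by apply/measurable_EFinP; exact: measurable_smoothed_pdf.
by move=> x; rewrite lee_fin smoothed_pdf_ge0.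
Qed.

(** [smoothed_pair_pdf] sums the real values of these integrals, with 0 in place of an infinite one.
    Each is integrable in the pair, so the substitution changes nothing almost everywhere. *)
Let ae_others : {ae leb_pair nx, forall ab, forall zs, others zs ab \is a fin_num}.
Proof.
apply: filter_forall => zs.
have : (leb_pair nx).-integrable [set: state * state] (others zs).
  apply/integrableP; split; first exact: measurable_others.
  under eq_integral do rewrite gee0_abs//.
  rewrite integral_others.
  have /integrableP[_] := integrable_smoothed_pdf u y th_param zs.
  by under eq_integral do rewrite /= ger0_norm ?smoothed_pdf_ge0//.
move/(integrable_ae measurableT) => h; apply: filterS h => ab; exact.
Qed.

Lemma measurable_smoothed_pair_pdf :
  measurable_fun [set: state * state]
    (fun ab => smoothed_pair_pdf u y th k ab.1 z ab.2 z').
Proof.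
rewrite /smoothed_pair_pdf; under eq_fun do rewrite -big_filter.
apply: measurable_sum => zs.
apply: (measurableT_comp (@fine_measurable R setT measurableT)).
exact: (measurable_others zs).
Qed.

Lemma smoothed_pair_pdf_ge0 x x' : 0 <= smoothed_pair_pdf u y th k x z x' z'.
Proof.
apply: sumr_ge0 => zs _; apply: Rintegral_ge0 => t _.
exact: smoothed_pdf_ge0.
Qed.

(** This carries the mixture hypothesis from densities to expectations: all other states are
    integrated out, the result is recognised as the pair density, and the mixture replaces it almost
    everywhere. Nonnegativity of [g] lets infinite values through. *)
Lemma integral_smoothed_pair (g : state * state -> \bar R) :
  measurable_fun [set: state * state] g -> (forall xx, (0 <= g xx)%E) ->
  (\sum_(zs : modes | (tnth zs (now k) == z) && (tnth zs (Defs.next k) == z'))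
     \int[leb_traj nx N.+1]_x
       (g (tnth x (now k), tnth x (Defs.next k)) * (s x zs)%:E) =
   \sum_(l < MS k) (w l z z')%:E *
     \int[leb_pair nx]_xx (g xx * (component l z z' xx)%:E))%E.
Proof.
move=> mg g0.
transitivity (\int[leb_pair nx]_ab
    (g ab * (smoothed_pair_pdf u y th k ab.1 z ab.2 z')%:E))%E.
  transitivity (\int[leb_pair nx]_ab (\sum_(zs : modes |
      (tnth zs (now k) == z) && (tnth zs (Defs.next k) == z'))
        (g ab * others zs ab)))%E.
    under [RHS]eq_integral do rewrite -big_filter.
    rewrite ge0_integral_sum//; last 2 first.
    - by move=> zs; exact: emeasurable_funM.
    - by move=> zs ab _; exact: mule_ge0.
    rewrite -big_filter; apply: eq_bigr => zs _.
    rewrite (integral_insert_pair k); last 2 first.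
    - apply: emeasurable_funM.
        apply: (measurableT_comp mg).
        by apply: measurable_fun_pair; exact: measurable_tnth.
      by apply/measurable_EFinP; exact: measurable_smoothed_pdf.
    - by move=> x; rewrite mule_ge0 ?lee_fin ?smoothed_pdf_ge0.
    apply: eq_integral => -[a b] _.
    under eq_integral do rewrite tnth_insert_pair_now tnth_insert_pair_next.
    rewrite ge0_integralZl//.
      exact: (measurable_fun_pair2 (a, b) (measurable_s_insert zs)).
    by move=> t _; rewrite lee_fin smoothed_pdf_ge0.
  have ms (zs : modes) := measurable_others zs.
  apply: ge0_ae_eq_integral => //.
  - under eq_fun do rewrite -big_filter.
    by apply: emeasurable_sum => zs; exact: emeasurable_funM.
  - apply: emeasurable_funM => //.
    by apply/measurable_EFinP; exact: measurable_smoothed_pair_pdf.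
  - by move=> ab _; apply: sume_ge0 => zs _; exact: mule_ge0.
  - by move=> ab _; rewrite mule_ge0 ?lee_fin ?smoothed_pair_pdf_ge0.
  apply: filterS ae_others => ab fin_ab _.
  rewrite -ge0_sume_distrr//; congr (_ * _)%E.
  rewrite -sumEFin; apply: eq_bigr => zs _.
  by rewrite -[LHS](fineK (fin_ab zs)).
case: mix => w0 _ /(_ k z z') mixk.
transitivity (\int[leb_pair nx]_ab (\sum_(l < MS k)
    (w l z z')%:E * (g ab * (component l z z' ab)%:E)))%E.
  apply: ge0_ae_eq_integral => //.
  - apply: emeasurable_funM => //.
    by apply/measurable_EFinP; exact: measurable_smoothed_pair_pdf.
  - apply: emeasurable_sum => l; apply: emeasurable_funM => //.
    by apply: emeasurable_funM => //; apply/measurable_EFinP; exact: measurable_component.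
  - by move=> ab _; rewrite mule_ge0 ?lee_fin ?smoothed_pair_pdf_ge0.
  - by move=> ab _; apply: sume_ge0 => l _; rewrite !mule_ge0 ?lee_fin ?component_ge0.
  apply: filterS mixk => ab -> _.
  rewrite -sumEFin ge0_sume_distrr; last first.
    by move=> l _; rewrite lee_fin mulr_ge0// component_ge0.
  by apply: eq_bigr => l _; rewrite EFinM muleCA.
rewrite ge0_integral_sum//; last 2 first.
- move=> l; apply: emeasurable_funM => //.
  by apply: emeasurable_funM => //; apply/measurable_EFinP; exact: measurable_component.
- by move=> l ab _; rewrite !mule_ge0 ?lee_fin ?component_ge0.
apply: eq_bigr => l _; rewrite ge0_integralZl ?lee_fin//.
- by apply: emeasurable_funM => //; apply/measurable_EFinP; exact: measurable_component.
- by move=> ab _; rewrite mule_ge0 ?lee_fin ?component_ge0.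
Qed.

End pair_marginal.

Lemma sum_modes_pair (V : nmodType) k (F : modes -> V) :
  \sum_(zs : modes) F zs = \sum_(z < m) \sum_(z' < m)
    \sum_(zs : modes | (tnth zs (now k) == z) && (tnth zs (Defs.next k) == z')) F zs.
Proof.
rewrite pair_bigA /= (partition_big
  (fun zs : modes => (tnth zs (now k), tnth zs (Defs.next k))) xpredT)//=.
Qed.

Lemma integral_smoothed_pair_cst k z z' :
  (\sum_(zs : modes | (tnth zs (now k) == z) && (tnth zs (Defs.next k) == z'))
     \int[leb_traj nx N.+1]_x (s x zs)%:E = (\sum_(l < MS k) w l z z')%:E)%E.
Proof.
have := @integral_smoothed_pair k z z' (cst 1%E) (measurable_cst _) (fun=> lee01).
under eq_bigr do under eq_integral do rewrite mul1e.
move=> ->; rewrite -sumEFin; apply: eq_bigr => l _.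
by under eq_integral do rewrite mul1e; rewrite integral_component mule1.
Qed.

Lemma weight_ge0 k (l : 'I_(MS k)) z z' : 0 <= w l z z'.
Proof. by case: mix. Qed.

(** Without modes the total mass of the initial density would be an empty sum, hence 0 and not 1. *)
Lemma param_mode : exists z : 'I_m, True.
Proof.
case: (pickP (@predT 'I_m)) => [z _|m0]; first by exists z.
case: th_param => -[_ _]; rewrite big_pred0 => [/eqP|z]; last exact: m0.
by rewrite eqe eq_sym oner_eq0.
Qed.

(** Zero evidence would make the smoothed density 0 by the division convention, so all pair masses,
    and with them [cm], would vanish. *)
Lemma evidence_neq0 : (forall z, 0 < cm (@w) z) -> evidence u y th != 0.
Proof.
move=> cm0; apply/eqP => e0; have [z _] := param_mode.
have := cm0 z; rewrite /cm big1 ?ltxx// => k _; rewrite big1// => z' _.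
apply: EFin_inj; rewrite -integral_smoothed_pair_cst big1// => zs _.
by apply: integral0_eq => x _; rewrite /smoothed_pdf e0 invr0 mulr0.
Qed.

(** The integral of the absolute value along [zs] is one term of a sum of nonnegative terms, which
    [integral_smoothed_pair] equates with finitely many finite component integrals. *)
Lemma integrable_smoothed_pair k (zs : modes) (H : state * state -> R) :
  measurable_fun [set: state * state] H ->
  (forall l : 'I_(MS k), (leb_pair nx).-integrable [set: state * state] (EFin \o (fun xx =>
    H xx * component l (tnth zs (now k)) (tnth zs (Defs.next k)) xx))) ->
  (leb_traj nx N.+1).-integrable [set: traj N.+1]
    (EFin \o (fun x => H (tnth x (now k), tnth x (Defs.next k)) * s x zs)).
Proof.
set z := tnth zs (now k); set z' := tnth zs (Defs.next k) => mH IH.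
have mHx : measurable_fun [set: traj N.+1]
    (fun x => H (tnth x (now k), tnth x (Defs.next k))).
  apply: (measurableT_comp mH).
  by apply: measurable_fun_pair; exact: measurable_tnth.
have ms zs' := measurable_smoothed_pdf u y th_param zs'.
apply/integrableP; split.
  by apply/measurable_EFinP; exact: measurable_funM.
pose g : state * state -> \bar R := fun xx => (`|H xx|%:E)%E.
have g0 xx : (0 <= g xx)%E by rewrite lee_fin.
have mg : measurable_fun [set: state * state] g.
  by apply/measurable_EFinP; exact: measurableT_comp.
apply: (@le_lt_trans _ _ (\sum_(l < MS k) (w l z z')%:E *
    \int[leb_pair nx]_xx (g xx * (component l z z' xx)%:E))%E); last first.
  apply: lte_sum_pinfty => l _; rewrite lte_mul_pinfty ?lee_fin ?weight_ge0//.
  have /integrableP[_] := IH l.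
  congr (_ < _)%E; apply: eq_integral => xx _ /=.
  by rewrite normrM (ger0_norm (component_ge0 l z z' xx)) EFinM.
rewrite -(@integral_smoothed_pair k z z' g mg g0) (bigD1 zs) /= ?eqxx//.
apply: (@le_trans _ _ (\int[leb_traj nx N.+1]_x
    (g (tnth x (now k), tnth x (Defs.next k)) * (s x zs)%:E))%E); last first.
  rewrite leeDl//; apply: sume_ge0 => zs' _; apply: integral_ge0 => x _.
  by rewrite mule_ge0 ?lee_fin ?smoothed_pdf_ge0.
apply: ge0_le_integral => //.
- by apply/measurable_EFinP; apply: measurableT_comp => //; exact: measurable_funM.
- apply/measurable_EFinP; apply: measurable_funM => //.
  exact: measurableT_comp.
by move=> x _; rewrite -EFinM lee_fin normrM (ger0_norm (smoothed_pdf_ge0 _ _ _ _ _)).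
Qed.

Lemma Rintegral_smoothed_pair_ge0 k z z' (H : state * state -> R) :
  measurable_fun [set: state * state] H -> (forall xx, 0 <= H xx) ->
  (forall l : 'I_(MS k), (leb_pair nx).-integrable [set: state * state]
    (EFin \o (fun xx => H xx * component l z z' xx))) ->
  \sum_(zs : modes | (tnth zs (now k) == z) && (tnth zs (Defs.next k) == z'))
    \int[leb_traj nx N.+1]_x (H (tnth x (now k), tnth x (Defs.next k)) * s x zs) =
  \sum_(l < MS k) w l z z' * \int[leb_pair nx]_xx (H xx * component l z z' xx).
Proof.
move=> mH H0 IH; apply: EFin_inj; rewrite -!sumEFin.
transitivity (\sum_(zs : modes | (tnth zs (now k) == z) && (tnth zs (Defs.next k) == z'))
    \int[leb_traj nx N.+1]_x
      ((EFin \o H) (tnth x (now k), tnth x (Defs.next k)) * (s x zs)%:E))%E.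
  apply: eq_bigr => zs /andP[/eqP zk /eqP zk'].
  rewrite Rintegral_EFin; last by apply: integrable_smoothed_pair; rewrite ?zk ?zk'.
  by apply: eq_integral => x _ /=; rewrite EFinM.
rewrite integral_smoothed_pair; last 2 first.
- exact/measurable_EFinP.
- by move=> xx; rewrite lee_fin.
apply: eq_bigr => l _; by rewrite EFinM Rintegral_EFin.
Qed.

Lemma Rintegral_smoothed_pair k z z' (H : state * state -> R) :
  measurable_fun [set: state * state] H ->
  (forall l : 'I_(MS k), (leb_pair nx).-integrable [set: state * state]
    (EFin \o (fun xx => H xx * component l z z' xx))) ->
  \sum_(zs : modes | (tnth zs (now k) == z) && (tnth zs (Defs.next k) == z'))
    \int[leb_traj nx N.+1]_x (H (tnth x (now k), tnth x (Defs.next k)) * s x zs) =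
  \sum_(l < MS k) w l z z' * \int[leb_pair nx]_xx (H xx * component l z z' xx).
Proof.
(* [H] is the difference of the nonnegative functions [B] and [A], both integrable against each
   component. *)
move=> mH IH; pose A xx := `|H xx|; pose B xx := H xx + A xx.
have mA : measurable_fun [set: state * state] A by exact: measurableT_comp.
have mB : measurable_fun [set: state * state] B by exact: measurable_funD.
have A0 xx : 0 <= A xx by exact: normr_ge0.
have B0 xx : 0 <= B xx by have := ler_norm (- H xx); rewrite normrN /B /A; lra.
have IA (l : 'I_(MS k)) : (leb_pair nx).-integrable [set: state * state]
    (EFin \o (fun xx => A xx * component l z z' xx)).
  have := integrable_abse (IH l).
  apply: eq_integrable => // xx _ /=.
  by rewrite normrM (ger0_norm (component_ge0 _ _ _ _)).
have IB (l : 'I_(MS k)) : (leb_pair nx).-integrable [set: state * state]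
    (EFin \o (fun xx => B xx * component l z z' xx)).
  have := integrableD measurableT (IH l) (IA l).
  by apply: eq_integrable => // xx _ /=; rewrite -EFinD mulrDl.
transitivity
  (\sum_(zs : modes | (tnth zs (now k) == z) && (tnth zs (Defs.next k) == z'))
    (\int[leb_traj nx N.+1]_x (B (tnth x (now k), tnth x (Defs.next k)) * s x zs) -
     \int[leb_traj nx N.+1]_x (A (tnth x (now k), tnth x (Defs.next k)) * s x zs))).
  apply: eq_bigr => zs /andP[/eqP zk /eqP zk'].
  rewrite -RintegralB//; last 2 first.
  - by apply: integrable_smoothed_pair; rewrite ?zk ?zk'.
  - by apply: integrable_smoothed_pair; rewrite ?zk ?zk'.
  by apply: eq_Rintegral => x _; rewrite -mulrBl /B addrK.
rewrite sumrB !Rintegral_smoothed_pair_ge0// -sumrB; apply: eq_bigr => l _.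
rewrite -mulrBr -RintegralB//; congr (_ * _).
by apply: eq_Rintegral => xx _; rewrite -mulrBl /B addrK.
Qed.

Lemma sum_Rintegral_smoothed k (G : 'I_m -> 'I_m -> state * state -> R) :
  (forall z z', measurable_fun [set: state * state] (G z z')) ->
  (forall z z' (l : 'I_(MS k)), (leb_pair nx).-integrable [set: state * state]
    (EFin \o (fun xx => G z z' xx * component l z z' xx))) ->
  \sum_(zs : modes) \int[leb_traj nx N.+1]_x
    (G (tnth zs (now k)) (tnth zs (Defs.next k))
       (tnth x (now k), tnth x (Defs.next k)) * s x zs) =
  \sum_(z < m) \sum_(z' < m) \sum_(l < MS k) w l z z' *
    \int[leb_pair nx]_xx (G z z' xx * component l z z' xx).
Proof.
move=> mG IG; rewrite (sum_modes_pair k); apply: eq_bigr => z _.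
apply: eq_bigr => z' _; rewrite -Rintegral_smoothed_pair//.
by apply: eq_bigr => zs /andP[/eqP -> /eqP ->].
Qed.

(** * The marginal at the first time *)

Section initial_marginal.
Variable k0 : 'I_N.
Hypothesis k00 : k0 = 0 :> nat.

Lemma now0 : now k0 = ord0.
Proof. exact: val_inj. Qed.

(* The mixture form of the smoothed density of (X_1, Z_1). *)
Definition init_mixture (x : state) (z : 'I_m) : R :=
  \sum_(z' < m) \sum_(l < MS k0) w l z z' *
    gauss_pdf (usubmx (mu l z z')) (ulsubmx (P l z z')) (vec x).

Lemma init_mixture_ge0 x z : 0 <= init_mixture x z.
Proof.
apply: sumr_ge0 => z' _; apply: sumr_ge0 => l _.
by rewrite mulr_ge0 ?weight_ge0 ?gauss_pdf_ge0.
Qed.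

Lemma measurable_marginal (l : 'I_(MS k0)) z z' : measurable_fun [set: state]
  (fun x => gauss_pdf (usubmx (mu l z z')) (ulsubmx (P l z z')) (vec x)).
Proof.
apply: measurable_gauss_pdf; first exact: measurable_vec_cst.
by apply: measurable_vec_vec; exact: measurable_id.
Qed.

Lemma measurable_init_mixture z : measurable_fun [set: state] (init_mixture ^~ z).
Proof.
apply: measurable_sum => z'; apply: measurable_sum => l.
by apply: measurable_funM => //; exact: measurable_marginal.
Qed.

Lemma integral_component_fst (l : 'I_(MS k0)) z z' (g : state -> \bar R) :
  measurable_fun [set: state] g -> (forall x, (0 <= g x)%E) ->
  (\int[leb_pair nx]_xx (g xx.1 * (component l z z' xx)%:E) =
   \int[leb nx]_x (g x *
     (gauss_pdf (usubmx (mu l z z')) (ulsubmx (P l z z')) (vec x))%:E))%E.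
Proof.
move=> mg g0; have mgc : measurable_fun [set: state * state]
    (fun xx => g xx.1 * (component l z z' xx)%:E)%E.
  apply: emeasurable_funM.
    by apply: (measurableT_comp mg); exact: measurable_fst.
  by apply/measurable_EFinP; exact: measurable_component.
rewrite [LHS](fubini_tonelli1 _ mgc); last first.
  by move=> xx; rewrite mule_ge0 ?lee_fin ?component_ge0.
case: mix => _ /(_ k0 l z z') Ppd _.
apply: eq_integral => x _; rewrite /fubini_F /= ge0_integralZl//.
- by congr (g x * _)%E; exact: (integral_gauss_pdf_dsub (mu l z z') (vec x) Ppd).
- apply/measurable_EFinP.
  exact: (measurable_fun_pair2 x (measurable_component l z z')).
- by move=> x' _; rewrite lee_fin component_ge0.
Qed.

(** The pair formula at [k0] is applied to [g \o fst] and summed over the second mode; integrating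
    out the second state leaves the first marginal of each component. *)
Lemma integral_smoothed_init z (g : state -> \bar R) :
  measurable_fun [set: state] g -> (forall x, (0 <= g x)%E) ->
  (\sum_(zs : modes | tnth zs ord0 == z)
     \int[leb_traj nx N.+1]_x (g (tnth x ord0) * (s x zs)%:E) =
   \int[leb nx]_x (g x * (init_mixture x z)%:E))%E.
Proof.
move=> mg g0.
rewrite (partition_big (fun zs : modes => tnth zs (Defs.next k0)) xpredT)//=.
transitivity (\sum_(z' < m) \sum_(l < MS k0) \int[leb nx]_x
    ((w l z z')%:E * (g x *
     (gauss_pdf (usubmx (mu l z z')) (ulsubmx (P l z z')) (vec x))%:E)))%E.
  apply: eq_bigr => z' _.
  have mg1 : measurable_fun [set: state * state] (g \o fst).
    by apply: (measurableT_comp mg); exact: measurable_fst.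
  have := @integral_smoothed_pair k0 z z' (g \o fst) mg1 (fun=> g0 _).
  rewrite now0 /= => ->; apply: eq_bigr => l _.
  rewrite integral_component_fst// ge0_integralZl ?lee_fin ?weight_ge0//.
  - by apply: emeasurable_funM => //; apply/measurable_EFinP; exact: measurable_marginal.
  - by move=> x _; rewrite mule_ge0 ?lee_fin ?gauss_pdf_ge0.
have mt (z' : 'I_m) (l : 'I_(MS k0)) : measurable_fun [set: state] (fun x =>
    ((w l z z')%:E * (g x *
     (gauss_pdf (usubmx (mu l z z')) (ulsubmx (P l z z')) (vec x))%:E)))%E.
  apply: emeasurable_funM => //; apply: emeasurable_funM => //.
  by apply/measurable_EFinP; exact: measurable_marginal.
have t0 (z' : 'I_m) (l : 'I_(MS k0)) x : (0 <= (w l z z')%:E * (g x *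
     (gauss_pdf (usubmx (mu l z z')) (ulsubmx (P l z z')) (vec x))%:E))%E.
  by rewrite !mule_ge0 ?lee_fin ?weight_ge0 ?gauss_pdf_ge0.
under eq_bigr do rewrite -ge0_integral_sum//.
rewrite -ge0_integral_sum//; last 2 first.
- by move=> z'; exact: emeasurable_sum.
- by move=> z' x _; exact: sume_ge0.
apply: eq_integral => x _.
rewrite /init_mixture -sumEFin ge0_sume_distrr; last first.
  move=> z' _; rewrite lee_fin; apply: sumr_ge0 => l _.
  by rewrite mulr_ge0 ?weight_ge0 ?gauss_pdf_ge0.
apply: eq_bigr => z' _; rewrite -sumEFin ge0_sume_distrr; last first.
  by move=> l _; rewrite lee_fin mulr_ge0 ?weight_ge0 ?gauss_pdf_ge0.
by apply: eq_bigr => l _; rewrite EFinM muleCA.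
Qed.

End initial_marginal.

End mixture.

(** * Expected log-likelihood *)

Section expected_log_likelihood.
Context {R : realType} {m nx nu ny N : nat}.
Variables (u : 'I_N -> 'cV[R]_nu) (y : 'I_N -> 'cV[R]_ny).
Variable th : @param R m nx nu ny.
Variable MS : 'I_N -> nat.
Variable w : forall k : 'I_N, 'I_(MS k) -> 'I_m -> 'I_m -> R.
Variable mu : forall k : 'I_N, 'I_(MS k) -> 'I_m -> 'I_m -> 'cV[R]_(nx + nx).
Variable P : forall k : 'I_N, 'I_(MS k) -> 'I_m -> 'I_m -> 'M[R]_(nx + nx).
Hypothesis th_param : is_param th.
Hypothesis mix : is_smoothed_mixture u y w mu P th.
Local Notation state := (nx.-tuple (measurableTypeR R)).
Local Notation traj n := (n.-tuple state).
Local Notation modes := (N.+1.-tuple 'I_m).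
Local Notation s := (smoothed_pdf u y th).
Local Notation component := (component mu P).

Section moments.
Variables (k : 'I_N) (l : 'I_(MS k)) (z z' : 'I_m).
Local Notation sq_int := (sq_integrable (leb_pair nx) (component l z z')).

Let Ppd : pos_def (P l z z').
Proof. by case: mix. Qed.

Let mg := measurable_component mu P l z z'.
Let g0 := component_ge0 mu P l z z'.
Let Ig := integrable_component mix l z z'.

(** The centred coordinate squared is dominated by a multiple of the Gaussian with doubled
    covariance ([sqr_gauss_pdf_le]); adding the mean back preserves square integrability. *)
Lemma sq_integrable_coord i :
  sq_int (fun xx => (col_mx (vec xx.1) (vec xx.2) : 'cV[R]_(nx + nx)) i 0).
Proof.
have mv : measurable_vec (fun xx : state * state => col_mx (vec xx.1) (vec xx.2)).
  by apply: measurable_vec_col; apply: measurable_vec_vec;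
    [exact: measurable_fst|exact: measurable_snd].
rewrite [X in sq_integrable _ _ X](_ : _ = fun xx : state * state =>
    ((col_mx (vec xx.1) (vec xx.2) : 'cV[R]_(nx + nx)) i 0 - mu l z z' i 0) +
    mu l z z' i 0); last by apply/funext => xx; rewrite subrK.
apply: (sq_integrableD mg g0); last exact: sq_integrable_cst.
split; first by apply: measurable_funB.
have [K K0 HK] := sqr_gauss_pdf_le (mu l z z') i Ppd.
have P2 : pos_def (2 *: P l z z') by exact: pos_defZ.
apply: (le_integrable measurableT _ _
  (integrableZl measurableT K (integrable_gauss_pdf_pair (mu l z z') P2))).
  apply/measurable_EFinP; apply: measurable_funM => //.
  by apply: measurable_funX; exact: measurable_funB.
move=> xx _; rewrite /= lee_fin !ger0_norm.
- exact: HK.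
- by rewrite mulr_ge0// gauss_pdf_ge0.
- by apply: mulr_ge0; [exact: sqr_ge0|exact: g0].
Qed.

Lemma sq_integrable_stacked k' a :
  sq_int (fun xx => stacked u y k' xx.1 xx.2 a 0).
Proof.
rewrite /stacked -(splitK a); case: splitP => i _ /=.
  rewrite [X in sq_integrable _ _ X](_ : _ = fun xx : state * state =>
    (col_mx (vec xx.1) (vec xx.2) : 'cV[R]_(nx + nx)) (lshift nx i) 0).
    exact: sq_integrable_coord.
  by apply/funext => xx; rewrite !col_mxEu.
rewrite -(splitK i); case: splitP => j _ /=.
  rewrite [X in sq_integrable _ _ X](_ : _ = fun xx : state * state =>
    (col_mx (vec xx.1) (vec xx.2) : 'cV[R]_(nx + nx)) (rshift nx j) 0).
    exact: sq_integrable_coord.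
  by apply/funext => xx; rewrite !(col_mxEd, col_mxEu).
rewrite [X in sq_integrable _ _ X](_ : _ = fun=> col_mx (u k') (y k') j 0).
  exact: sq_integrable_cst.
by apply/funext => xx; rewrite !col_mxEd.
Qed.

Lemma integrable_stacked k' a b :
  (leb_pair nx).-integrable [set: state * state] (EFin \o (fun xx =>
    (stacked u y k' xx.1 xx.2 *m (stacked u y k' xx.1 xx.2)^T) a b *
    component l z z' xx)).
Proof.
have := sq_integrable_mul mg g0 (sq_integrable_stacked k' a) (sq_integrable_stacked k' b).
by apply: eq_integrable => // xx _ /=; rewrite !mxE big_ord1 !mxE.
Qed.

(** The expectation of a quadratic form is the trace of its matrix against the second moments; the
    constant survives unchanged because the component has mass 1. *)
Lemma Rintegral_quadratic (c : R) (B : 'M[R]_(nx + (nx + (nu + ny)))) :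
  (leb_pair nx).-integrable [set: state * state] (EFin \o (fun xx =>
    (c + qform B (stacked u y k xx.1 xx.2)) * component l z z' xx)) /\
  \int[leb_pair nx]_xx
    ((c + qform B (stacked u y k xx.1 xx.2)) * component l z z' xx) =
  c + \tr (B *m \matrix_(a, b) expect mu P z z' l
      (fun x x' => (stacked u y k x x' *m (stacked u y k x x')^T) a b)).
Proof.
pose F a b (xx : state * state) := B a b *
  ((stacked u y k xx.1 xx.2 *m (stacked u y k xx.1 xx.2)^T) b a * component l z z' xx).
have IF a b : (leb_pair nx).-integrable [set: state * state] (EFin \o F a b).
  have := integrableZl measurableT (B a b) (integrable_stacked k b a).
  by apply: eq_integrable => // xx _ /=; rewrite -EFinM.
pose H xx := \sum_a \sum_b F a b xx.
have IH : (leb_pair nx).-integrable [set: state * state] (EFin \o H).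
  by apply: integrable_sumr => a; exact: integrable_sumr.
have Ic : (leb_pair nx).-integrable [set: state * state]
    (EFin \o (fun xx => c * component l z z' xx)).
  have := integrableZl measurableT c Ig.
  by apply: eq_integrable => // xx _ /=; rewrite -EFinM.
have E xx : (c + qform B (stacked u y k xx.1 xx.2)) * component l z z' xx =
    c * component l z z' xx + H xx.
  rewrite mulrDl; congr (_ + _); rewrite qform_sum mulr_suml.
  apply: eq_bigr => a _; rewrite mulr_suml; apply: eq_bigr => b _.
  rewrite /F -mulrA; congr (_ * (_ * _)).
  by rewrite [RHS]mxE big_ord1 [X in _ = _ * X]mxE mulrC.
split.
  have := integrableD measurableT Ic IH.
  by apply: eq_integrable => // xx _ /=; rewrite E EFinD.
under eq_Rintegral do rewrite E.
rewrite RintegralD// RintegralZl//; congr (_ + _).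
  rewrite [X in _ * X](_ : _ = 1) ?mulr1//.
  by apply: EFin_inj; rewrite Rintegral_EFin// (integral_component mix).
rewrite Rintegral_sum; last by move=> a; exact: integrable_sumr.
apply: eq_bigr => a _; rewrite mxE Rintegral_sum//; apply: eq_bigr => b _.
rewrite RintegralZl//; last exact: integrable_stacked.
by rewrite [in RHS]mxE.
Qed.

End moments.

Definition log_factor (th2 : @param R m nx nu ny) (k : 'I_N) (z : 'I_m)
    (xx : state * state) : R :=
  ln (gauss_pdf (Gam th2 z *m col_mx (vec xx.1) (u k)) (Pi th2 z)
    (col_mx (y k) (vec xx.2))).

Lemma residual_stacked (G : 'M[R]_(ny + nx, nx + nu)) k (x x' : state) :
  residual_mx G *m stacked u y k x x' =
  col_mx (y k) (vec x') - G *m col_mx (vec x) (u k).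
Proof.
rewrite /residual_mx mulmxBl -mulmxA /T1 /T2 /stacked !mul_col_mx !mul_row_col.
by rewrite !(mul0mx, mul1mx, addr0, add0r).
Qed.

Definition log_const (th2 : @param R m nx nu ny) (z : 'I_m) : R :=
  ln ((2 * pi) ^+ (ny + nx) * \det (Pi th2 z)).

Definition log_form (th2 : @param R m nx nu ny) (z : 'I_m) :
    'M[R]_(nx + (nx + (nu + ny))) :=
  (residual_mx (Gam th2 z))^T *m invmx (Pi th2 z) *m residual_mx (Gam th2 z).

(** In the stacked vector the Gaussian log-factor is a constant plus a quadratic form, the shape
    that [Rintegral_quadratic] treats. *)
Lemma log_factorE th2 k z xx : pos_def (Pi th2 z) ->
  log_factor th2 k z xx = - (log_const th2 z / 2) +
    qform (- (2^-1 *: log_form th2 z)) (stacked u y k xx.1 xx.2).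
Proof.
move=> pd; rewrite /log_factor ln_gauss_pdf// -residual_stacked.
have -> : qform (- (2^-1 *: log_form th2 z)) (stacked u y k xx.1 xx.2) =
    - (2^-1 * qform (log_form th2 z) (stacked u y k xx.1 xx.2)).
  by rewrite /qform mulmxN mulNmx -scalemxAr -scalemxAl !mxE.
have -> : qform (log_form th2 z) (stacked u y k xx.1 xx.2) =
    qform (invmx (Pi th2 z)) (residual_mx (Gam th2 z) *m stacked u y k xx.1 xx.2).
  by rewrite /log_form -{2}[residual_mx _]trmxK qform_congr trmxK.
by rewrite -/(log_const th2 z); lra.
Qed.

Lemma integrable_log_factor th2 k (l : 'I_(MS k)) z z' : pos_def (Pi th2 z) ->
  (leb_pair nx).-integrable [set: state * state]
    (EFin \o (fun xx => log_factor th2 k z xx * component l z z' xx)).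
Proof.
move=> pd; have [I _] := Rintegral_quadratic l z z' (- (log_const th2 z / 2))
  (- (2^-1 *: log_form th2 z)).
by apply: eq_integrable I => // xx _ /=; rewrite log_factorE.
Qed.

Lemma measurable_log_factor th2 k z :
  measurable_fun [set: state * state] (log_factor th2 k z).
Proof.
apply: measurableT_comp; first exact: measurable_ln.
apply: measurable_gauss_pdf.
  apply: measurable_vec_mulmx; apply: measurable_vec_col; last exact: measurable_vec_cst.
  by apply: measurable_vec_vec; exact: measurable_fst.
apply: measurable_vec_col; first exact: measurable_vec_cst.
by apply: measurable_vec_vec; exact: measurable_snd.
Qed.

Lemma sum_log_factor th2 : (forall z, pos_def (Pi th2 z)) ->
  \sum_(k < N) \sum_(zs : modes) \int[leb_traj nx N.+1]_x
    (log_factor th2 k (tnth zs (now k)) (tnth x (now k), tnth x (Defs.next k)) *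
     s x zs) =
  \sum_(z < m) - ((cm w z * log_const th2 z +
    \tr (log_form th2 z *m Mmx u y w mu P z)) / 2).
Proof.
move=> pd.
transitivity (\sum_(k < N) \sum_(z < m) \sum_(z' < m) \sum_(l < MS k) w l z z' *
  (- ((log_const th2 z + \tr (log_form th2 z *m \matrix_(a, b) expect mu P z z' l
    (fun x x' => (stacked u y k x x' *m (stacked u y k x x')^T) a b))) / 2))).
  apply: eq_bigr => k _.
  rewrite (sum_Rintegral_smoothed th_param mix (G := fun z _ => log_factor th2 k z)).
  - apply: eq_bigr => z _; apply: eq_bigr => z' _; apply: eq_bigr => l _.
    congr (_ * _); under eq_Rintegral do rewrite log_factorE//.
    rewrite (Rintegral_quadratic l z z' _ _).2.
    by rewrite mulNmx -scalemxAl raddfN/= mxtraceZ; lra.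
  - by move=> z z'; exact: measurable_log_factor.
  - by move=> z z' l; exact: integrable_log_factor.
rewrite exchange_big; apply: eq_bigr => z _ /=.
rewrite /cm /Mmx mulmx_sumr raddf_sum mulr_suml -big_split /= mulr_suml -sumrN.
apply: eq_bigr => k _; rewrite mulmx_sumr raddf_sum mulr_suml -big_split /=.
rewrite mulr_suml -sumrN; apply: eq_bigr => z' _.
rewrite mulmx_sumr raddf_sum mulr_suml -big_split /= mulr_suml -sumrN.
apply: eq_bigr => l _; rewrite -scalemxAr mxtraceZ; lra.
Qed.

Lemma sum_cst (k : 'I_N) (G : 'I_m -> 'I_m -> R) :
  \sum_(zs : modes) \int[leb_traj nx N.+1]_x
    (G (tnth zs (now k)) (tnth zs (Defs.next k)) * s x zs) =
  \sum_(z < m) \sum_(z' < m) (\sum_(l < MS k) w l z z') * G z z'.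
Proof.
rewrite (sum_Rintegral_smoothed th_param mix (G := fun z z' _ => G z z')).
- apply: eq_bigr => z _; apply: eq_bigr => z' _; rewrite mulr_suml.
  apply: eq_bigr => l _; congr (_ * _); rewrite RintegralZl//; last first.
    exact: (integrable_component mix).
  rewrite [X in _ * X](_ : _ = 1) ?mulr1//.
  apply: EFin_inj; rewrite Rintegral_EFin ?(integral_component mix)//.
  exact: (integrable_component mix).
- by move=> z z'; exact: measurable_cst.
- move=> z z' l; have := integrableZl measurableT (G z z') (integrable_component mix l z z').
  by apply: eq_integrable => // xx _ /=; rewrite -EFinM.
Qed.

End expected_log_likelihood.

(* Unlike in [le_integral], the integral of [f] may be -oo or undefined. *)
Lemma le_integral_integrable d (T : measurableType d) (R : realType)
    (nu : {measure set T -> \bar R}) (f h : T -> \bar R) :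
  measurable_fun [set: T] f -> nu.-integrable [set: T] h ->
  (forall x, (f x <= h x)%E) -> (\int[nu]_x f x <= \int[nu]_x h x)%E.
Proof.
move=> mf /measurable_int mh fh.
rewrite integralE [leRHS]integralE; apply: leeB; apply: ge0_le_integral => //.
- exact: measurable_funepos.
- exact: measurable_funepos.
- by move=> x _; apply: (funepos_le (D := setT)) => //; rewrite inE.
- exact: measurable_funeneg.
- exact: measurable_funeneg.
- by move=> x _; apply: (funeneg_le (D := setT)) => //; rewrite inE.
Qed.

(** A null set of head coordinates lifts to a cylinder, whose measure is 0 times the possibly
    infinite measure of the remaining coordinates, hence 0. *)
Lemma ae_tuple_head d (T : measurableType d) (R : realType)
    (nu : {sigma_finite_measure set T -> \bar R}) n (Q : T -> Prop) :
  {ae nu, forall x, Q x} ->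
  {ae tuple_measure nu n.+1, forall x : n.+1.-tuple T, Q (tnth x ord0)}.
Proof.
case=> A [mA A0 QA]; exists ((fun x : n.+1.-tuple T => tnth x ord0) @^-1` A); split.
- by rewrite -[X in measurable X]setTI; exact: measurable_tnth.
- rewrite [LHS]/= /cons_measure /pushforward.
  rewrite [X in (_ \x _)%E X](_ : _ = A `*` setT).
    transitivity (nu A * tuple_measure nu n setT)%E; first exact: product_measure1E.
    by rewrite A0 mul0e.
  by apply/seteqP; split => -[a t] /=; [move=> ?; split|case].
- by move=> x /= nQ; apply: QA.
Qed.

(** * The smoothed density of the initial state and mode *)

Section initial_density.
Context {R : realType} {m nx nu ny N : nat}.
Variables (u : 'I_N -> 'cV[R]_nu) (y : 'I_N -> 'cV[R]_ny).
Variable th : @param R m nx nu ny.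
Variable MS : 'I_N -> nat.
Variable w : forall k : 'I_N, 'I_(MS k) -> 'I_m -> 'I_m -> R.
Variable mu : forall k : 'I_N, 'I_(MS k) -> 'I_m -> 'I_m -> 'cV[R]_(nx + nx).
Variable P : forall k : 'I_N, 'I_(MS k) -> 'I_m -> 'I_m -> 'M[R]_(nx + nx).
Hypothesis th_param : is_param th.
Hypothesis mix : is_smoothed_mixture u y w mu P th.
Variable k0 : 'I_N.
Hypothesis k00 : k0 = 0 :> nat.
Local Notation state := (nx.-tuple (measurableTypeR R)).
Local Notation traj n := (n.-tuple state).
Local Notation modes := (N.+1.-tuple 'I_m).
Local Notation s := (smoothed_pdf u y th).
Local Notation component := (component mu P).
Local Notation q := (init_mixture w mu P k0).

Let rest (zs : modes) (a : state) : \bar R :=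
  (\int[leb_traj nx N]_t (s [tuple of a :: t] zs)%:E)%E.

Let rest_ge0 zs a : (0 <= rest zs a)%E.
Proof. by apply: integral_ge0 => t _; rewrite lee_fin smoothed_pdf_ge0. Qed.

Let measurable_sE zs : measurable_fun [set: traj N.+1] (EFin \o (s ^~ zs)).
Proof. by apply/measurable_EFinP; exact: measurable_smoothed_pdf. Qed.

Let sE_ge0 zs x : (0 <= (s x zs)%:E)%E.
Proof. by rewrite lee_fin smoothed_pdf_ge0. Qed.

Let measurable_rest zs : measurable_fun [set: state] (rest zs).
Proof.
exact: (@measurable_integral_tuple_cons _ _ _ (leb nx) N _ (measurable_sE zs) (sE_ge0 zs)).
Qed.

Let integral_rest zs (g : state -> \bar R) :
  measurable_fun [set: state] g -> (forall x, (0 <= g x)%E) ->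
  (\int[leb_traj nx N.+1]_x (g (tnth x ord0) * (s x zs)%:E) =
   \int[leb nx]_a (g a * rest zs a))%E.
Proof.
move=> mg g0; rewrite [LHS](@integral_tuple_cons _ _ _ (leb nx) N); last 2 first.
- apply: emeasurable_funM; last exact: measurable_sE.
  by apply: (measurableT_comp mg); exact: measurable_tnth.
- by move=> x; exact: mule_ge0.
apply: eq_integral => a _; rewrite -ge0_integralZl//.
apply: (measurableT_comp (measurable_sE zs)).
exact: (measurable_fun_pair2 a (@measurable_consT _ _ N)).
Qed.

Let ae_rest : {ae leb nx, forall a, forall zs, rest zs a \is a fin_num}.
Proof.
apply: filter_forall => zs.
have : (leb nx).-integrable [set: state] (rest zs).
  apply/integrableP; split; first exact: measurable_rest.
  under eq_integral do rewrite gee0_abs//.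
  have := @integral_rest zs (cst 1%E) (measurable_cst _) (fun=> lee01).
  under [in RHS]eq_integral do rewrite mul1e.
  move=> <-; under eq_integral do rewrite mul1e.
  have /integrableP[_] := integrable_smoothed_pdf u y th_param zs.
  congr (_ < _)%E; apply: eq_integral => x _.
  by rewrite /= ger0_norm ?smoothed_pdf_ge0.
move/(integrable_ae measurableT) => h; apply: filterS h => a; exact.
Qed.

Lemma measurable_smoothed_init_pdf z :
  measurable_fun [set: state] (smoothed_init_pdf u y th ^~ z).
Proof.
rewrite /smoothed_init_pdf; under eq_fun do rewrite -big_filter.
apply: measurable_sum => zs.
apply: (measurableT_comp (@fine_measurable R setT measurableT)).
exact: (measurable_rest zs).
Qed.

Lemma smoothed_init_pdf_ge0 x z : 0 <= smoothed_init_pdf u y th x z.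
Proof.
by apply: sumr_ge0 => zs _; apply: Rintegral_ge0 => t _; exact: smoothed_pdf_ge0.
Qed.

Lemma integral_smoothed_init_pdf z (g : state -> \bar R) :
  measurable_fun [set: state] g -> (forall x, (0 <= g x)%E) ->
  (\int[leb nx]_x (g x * (smoothed_init_pdf u y th x z)%:E) =
   \int[leb nx]_x (g x * (q x z)%:E))%E.
Proof.
move=> mg g0; rewrite -(integral_smoothed_init th_param mix k00 z mg g0).
under [RHS]eq_bigr do rewrite integral_rest//.
rewrite -[in RHS]big_filter -ge0_integral_sum//; last 2 first.
- by move=> zs; exact: emeasurable_funM.
- by move=> zs a _; exact: mule_ge0.
apply: ge0_ae_eq_integral => //.
- apply: emeasurable_funM => //.
  by apply/measurable_EFinP; exact: measurable_smoothed_init_pdf.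
- by apply: emeasurable_sum => zs; exact: emeasurable_funM.
- by move=> a _; rewrite mule_ge0 ?lee_fin ?smoothed_init_pdf_ge0.
- by move=> a _; apply: sume_ge0 => zs _; exact: mule_ge0.
apply: filterS ae_rest => a fin_a _.
rewrite big_filter -ge0_sume_distrr//; congr (_ * _)%E.
rewrite -sumEFin; apply: eq_bigr => zs _.
by rewrite -[RHS](fineK (fin_a zs)).
Qed.

Lemma integral_init_mixture z :
  (\int[leb nx]_x (q x z)%:E =
   \sum_(zs : modes | tnth zs ord0 == z) \int[leb_traj nx N.+1]_x (s x zs)%:E)%E.
Proof.
have := @integral_smoothed_init _ _ _ _ _ _ _ _ _ _ _ _ _ th_param mix k0 k00 z
  (cst 1%E) (measurable_cst _) (fun=> lee01).
under eq_bigr do under eq_integral do rewrite mul1e.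
by under [RHS]eq_integral do rewrite mul1e.
Qed.

Let measurable_qE z : measurable_fun [set: state] (EFin \o (q ^~ z)).
Proof. by apply/measurable_EFinP; exact: measurable_init_mixture. Qed.

Lemma integrable_init_mixture z : (leb nx).-integrable [set: state] (EFin \o (q ^~ z)).
Proof.
apply/integrableP; split; first exact: measurable_qE.
under eq_integral do rewrite /= ger0_norm ?(init_mixture_ge0 mix)//.
rewrite integral_init_mixture; apply: lte_sum_pinfty => zs _.
have /integrableP[_] := integrable_smoothed_pdf u y th_param zs.
congr (_ < _)%E; apply: eq_integral => x _.
  by rewrite /= ger0_norm ?smoothed_pdf_ge0.
Qed.

(** Taking indicators as test functions in [integral_smoothed_init_pdf] gives equal integrals over
    every measurable set; the mixture being integrable, the densities agree almost everywhere. *)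
Lemma smoothed_init_pdf_mixture z :
  {ae leb nx, forall x, smoothed_init_pdf u y th x z = q x z}.
Proof.
have : ae_eq (leb nx) [set: state] (EFin \o (q ^~ z))
    (EFin \o (smoothed_init_pdf u y th ^~ z)).
  apply: integral_ae_eq => //.
  - exact: integrable_init_mixture.
  - by apply/measurable_EFinP; exact: measurable_smoothed_init_pdf.
  move=> E _ mE.
  have indE (f : state -> R) : (\int[leb nx]_(x in E) (f x)%:E =
      \int[leb nx]_x ((\1_E x)%:E * (f x)%:E))%E.
    rewrite integral_mkcond; apply: eq_integral => x _.
    rewrite patchE indicE; case: (x \in E); first by rewrite mul1e.
    by rewrite mul0e.
  rewrite !indE; apply/esym/integral_smoothed_init_pdf.
    by apply/measurable_EFinP; exact: measurable_indic.
  by move=> x; rewrite lee_fin indicE; case: (x \in E).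
by move=> h; apply: filterS h => x /(_ I) /= -[].
Qed.

Lemma integral_smoothed_init_pdf1 z :
  (\int[leb nx]_x (smoothed_init_pdf u y th x z)%:E = \int[leb nx]_x (q x z)%:E)%E.
Proof.
have := @integral_smoothed_init_pdf z (cst 1%E) (measurable_cst _) (fun=> lee01).
under eq_integral do rewrite mul1e.
by under [in RHS]eq_integral do rewrite mul1e.
Qed.

Lemma init_mixture_gt0 z z' (l : 'I_(MS k0)) : 0 < w l z z' -> forall x, 0 < q x z.
Proof.
move=> w0 x; rewrite /init_mixture (bigD1 z')//= ltr_pwDl//; last first.
  apply: sumr_ge0 => z1 _; apply: sumr_ge0 => l1 _.
  by rewrite mulr_ge0 ?(weight_ge0 mix) ?gauss_pdf_ge0.
rewrite (bigD1 l)//= ltr_pwDl//; last first.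
  by apply: sumr_ge0 => l1 _; rewrite mulr_ge0 ?(weight_ge0 mix) ?gauss_pdf_ge0.
by rewrite mulr_gt0// gauss_pdf_gt0//; apply: pos_def_ul; case: mix.
Qed.

(* A Gaussian mixture is bounded above by a constant, and below by a positive
   multiple of one of its components, whose logarithm is quadratic. *)
Lemma integrable_ln_init_mixture (l : 'I_(MS k0)) z z' :
  (leb_pair nx).-integrable [set: state * state]
    (EFin \o (fun xx => ln (q xx.1 z) * component l z z' xx)).
Proof.
have mg := measurable_component mu P l z z'.
have g0 := component_ge0 mu P l z z'.
have Ig := integrable_component mix l z z'.
have mlnq : measurable_fun [set: state * state] (fun xx => ln (q xx.1 z)).
  apply: measurableT_comp; first exact: measurable_ln.
  by apply: (measurableT_comp (measurable_init_mixture w mu P k0 z)); exact: measurable_fst.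
(* If all weights at [z] vanish, the mixture is identically 0 and the convention [ln 0 = 0] makes
   the integrand 0. *)
case: (pselect (exists z1 (l1 : 'I_(MS k0)), 0 < w l1 z z1)); last first.
  move=> now; have q0 x : q x z = 0.
    rewrite /init_mixture big1// => z1 _; rewrite big1// => l1 _.
    suff -> : w l1 z z1 = 0 by rewrite mul0r.
    apply/eqP; rewrite eq_le (weight_ge0 mix) andbT leNgt; apply/negP => w0.
    by apply: now; exists z1, l1.
  apply: eq_integrable (integrable0 _ _) => // xx _ /=.
  by rewrite q0 ln0// mul0r.
move=> [z1 [l1 w1]].
have P1pd : pos_def (ulsubmx (P l1 z z1)) by apply: pos_def_ul; case: mix.
pose K := \sum_(z2 < m) \sum_(l2 < MS k0) w l2 z z2 *
  (Num.sqrt ((2 * pi) ^+ nx * \det (ulsubmx (P l2 z z2))))^-1.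
have qK x : q x z <= K.
  apply: ler_sum => z2 _; apply: ler_sum => l2 _.
  rewrite ler_wpM2l ?(weight_ge0 mix)//; apply: gauss_pdf_le.
  by apply: pos_def_ul; case: mix.
pose m1 := usubmx (mu l1 z z1); pose Q1 := invmx (ulsubmx (P l1 z z1)).
pose c1 := ln ((2 * pi) ^+ nx * \det (ulsubmx (P l1 z z1))).
pose F (xx : state * state) := qform Q1 (vec xx.1 - m1).
have F0 xx : 0 <= F xx by exact/pos_def_qform_ge0/pos_def_inv.
have IF : (leb_pair nx).-integrable [set: state * state]
    (EFin \o (fun xx => F xx * component l z z' xx)).
  have sq i : sq_integrable (leb_pair nx) (component l z z')
      (fun xx : state * state => (vec xx.1 - m1) i 0).
    rewrite [X in sq_integrable _ _ X](_ : _ = fun xx : state * state =>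
      (col_mx (vec xx.1) (vec xx.2) : 'cV[R]_(nx + nx)) (lshift nx i) 0 + - m1 i 0).
      apply: (sq_integrableD mg g0); first exact: (sq_integrable_coord mix).
      exact: sq_integrable_cst.
    by apply/funext => xx; rewrite col_mxEu [LHS]mxE [X in _ + X]mxE.
  have : (leb_pair nx).-integrable [set: state * state] (EFin \o (fun xx =>
      \sum_i \sum_j (Q1 i j * ((vec xx.1 - m1) i 0 * (vec xx.1 - m1) j 0 *
        component l z z' xx)))).
    apply: integrable_sumr => i; apply: integrable_sumr => j.
    have := integrableZl measurableT (Q1 i j) (sq_integrable_mul mg g0 (sq i) (sq j)).
    by apply: eq_integrable => // xx _ /=; rewrite -EFinM.
  apply: eq_integrable => // xx _ /=; congr EFin.
  rewrite /F qform_sum mulr_suml; apply: eq_bigr => i _; rewrite mulr_suml.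
  by apply: eq_bigr => j _; rewrite -[RHS]mulrA.
(* [K] covers the upper side, by [ln q <= q - 1]; the other two terms cover the weight and the
   normalising constant of the component bounding the mixture from below, whose quadratic part is
   left to [F]. *)
pose C := K + `|ln (w l1 z z1)| + `|c1|.
have K0 : 0 <= K.
  by apply: le_trans (qK [tuple 0 | i < nx]); exact: (init_mixture_ge0 mix).
have C0 : 0 <= C by rewrite !addr_ge0.
have lnq_le (x : state) : `|ln (q x z)| <= C + qform Q1 (vec x - m1).
  have q0 := init_mixture_gt0 w1 x.
  have up : ln (q x z) <= K.
    have := ln_le_subr1 q0; have := qK x; lra.
  have gp : 0 < gauss_pdf m1 (ulsubmx (P l1 z z1)) (vec x) by exact: gauss_pdf_gt0.
  have q_ge : w l1 z z1 * gauss_pdf m1 (ulsubmx (P l1 z z1)) (vec x) <= q x z.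
    rewrite /init_mixture (bigD1 z1)//= (bigD1 l1)//= -addrA lerDl.
    apply: addr_ge0; first apply: sumr_ge0 => l2 _.
      by rewrite mulr_ge0 ?(weight_ge0 mix) ?gauss_pdf_ge0.
    apply: sumr_ge0 => z2 _; apply: sumr_ge0 => l2 _.
    by rewrite mulr_ge0 ?(weight_ge0 mix) ?gauss_pdf_ge0.
  have : ln (w l1 z z1 * gauss_pdf m1 (ulsubmx (P l1 z z1)) (vec x)) <= ln (q x z).
    by rewrite ler_ln// posrE// mulr_gt0.
  rewrite lnM ?posrE// ln_gauss_pdf// -/c1 -/Q1.
  have := F0 (x, x); rewrite /F /=; set f := qform _ _ => f0 low.
  have := ler_norm (- ln (w l1 z z1)); have := ler_norm c1.
  have := normr_ge0 c1; have := normr_ge0 (ln (w l1 z z1)).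
  rewrite normrN => n0 n1 n2 n3.
  by rewrite ler_norml /C; apply/andP; split; lra.
have IC := integrableD measurableT (integrableZl measurableT C Ig) IF.
apply: (le_integrable measurableT _ _ IC).
  by apply/measurable_EFinP; exact: measurable_funM.
move=> xx _; rewrite /= lee_fin normrM (ger0_norm (g0 xx)) -mulrDl.
rewrite [leRHS]normrM (ger0_norm (g0 xx)) ler_wpM2r//.
by rewrite [leRHS]ger0_norm ?addr_ge0//; exact: lnq_le.
Qed.

End initial_density.

(** * Optimality *)

Section optimum.
Context {R : realType} {m nx nu ny N : nat}.
Variables (u : 'I_N -> 'cV[R]_nu) (y : 'I_N -> 'cV[R]_ny).
Variable th : @param R m nx nu ny.
Variable MS : 'I_N -> nat.
Variable w : forall k : 'I_N, 'I_(MS k) -> 'I_m -> 'I_m -> R.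
Variable mu : forall k : 'I_N, 'I_(MS k) -> 'I_m -> 'I_m -> 'cV[R]_(nx + nx).
Variable P : forall k : 'I_N, 'I_(MS k) -> 'I_m -> 'I_m -> 'M[R]_(nx + nx).
Variables (r : 'I_m -> nat) (Mh : forall z, 'M[R]_(r z, nx + (nx + (nu + ny)))).
Hypothesis th_param : is_param th.
Hypothesis mix : is_smoothed_mixture u y w mu P th.
Hypothesis Mh_sqrt : forall z, is_sqrt_factor (Mh z) (Mmx u y w mu P z).
Hypothesis cm_gt0 : forall z, 0 < cm w z.
Hypothesis Sigma_unit : forall z, Sigma (Mh z) \in unitmx.
Hypothesis Pi_pd : forall z, let Ph := Pi_half (Mh z) (cm w z) (Gam_opt (Mh z)) in
  pos_def (Ph^T *m Ph).
Variable k0 : 'I_N.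
Hypothesis k00 : k0 = 0 :> nat.
Local Notation state := (nx.-tuple (measurableTypeR R)).
Local Notation traj n := (n.-tuple state).
Local Notation modes := (N.+1.-tuple 'I_m).
Local Notation s := (smoothed_pdf u y th).
Local Notation q := (init_mixture w mu P k0).
Local Notation lebT := (leb_traj nx N.+1).

Definition theta_opt : @param R m nx nu ny :=
  Param (smoothed_init_pdf u y th)
    (\matrix_(z', z) ((\sum_(k < N) \sum_(j < MS k) w j z z') / cm w z))
    (fun z => Gam_opt (Mh z))
    (fun z => let Ph := Pi_half (Mh z) (cm w z) (Gam_opt (Mh z)) in Ph^T *m Ph).

Let w_ge0 k (l : 'I_(MS k)) z z' : 0 <= w l z z'.
Proof. exact: weight_ge0 mix _ _ _ _. Qed.

(** The columns of the optimal matrix already sum to 1, [cm] being the total weight leaving [z], so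
    normalising changes nothing. *)
Lemma trans_prob_opt z' z : trans_prob theta_opt z' z =
  (\sum_(k < N) \sum_(j < MS k) w j z z') / cm w z.
Proof.
rewrite /trans_prob /= mxE.
have -> : \sum_(l < m) (theta_opt.(Tmat)) l z = 1.
  under eq_bigr do rewrite /= mxE.
  rewrite -mulr_suml exchange_big /=.
  by rewrite -/(cm w z) mulfV// gt_eqF.
by rewrite divr1.
Qed.

Let evid : evidence u y th != 0.
Proof. exact: (evidence_neq0 th_param mix cm_gt0). Qed.

Lemma theta_opt_is_param : is_param theta_opt.
Proof.
split; last exact: Pi_pd.
- split => /=.
  + exact: (measurable_smoothed_init_pdf u y th_param).
  + exact: (smoothed_init_pdf_ge0 u y th_param).
  under eq_bigr do rewrite (integral_smoothed_init_pdf1 th_param mix k00).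
  under eq_bigr do rewrite (integral_init_mixture th_param mix k00).
  rewrite -(sum_integral_smoothed_pdf th_param evid).
  by rewrite [RHS](partition_big (fun zs : modes => tnth zs ord0) xpredT).
move=> j i; rewrite mxE divr_ge0 ?(ltW (cm_gt0 _))//.
by apply: sumr_ge0 => k _; apply: sumr_ge0.
Qed.

Let s_ge0 x zs : 0 <= s x zs.
Proof. exact: (smoothed_pdf_ge0 u y th_param). Qed.

Let ms zs : measurable_fun [set: traj N.+1] (s ^~ zs).
Proof. exact: (measurable_smoothed_pdf u y th_param). Qed.

Let Is zs : lebT.-integrable [set: traj N.+1] (EFin \o (s ^~ zs)).
Proof. exact: (integrable_smoothed_pdf u y th_param). Qed.

Let mass zs := (\int[lebT]_x (s x zs)%:E)%E.

(** On such a sequence the smoothed density is 0 almost everywhere. This disposes of the sequences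
    along which the optimal log-density may be [-oo]. *)
Lemma null_modes zs (f : traj N.+1 -> \bar R) : mass zs = 0%E ->
  measurable_fun [set: traj N.+1] f -> (forall x, s x zs = 0 -> f x = 0%E) ->
  (\int[lebT]_x f x = 0)%E.
Proof.
move=> m0 mf f0; rewrite -[RHS](integral0 lebT setT); apply: ae_eq_integral => //.
have : ae_eq lebT [set: traj N.+1] (EFin \o (s ^~ zs)) (cst 0%E).
  apply/ae_eq_integral_abs => //; first exact: measurable_int (Is zs).
  by rewrite -[RHS]m0; apply: eq_integral => x _; rewrite /= ger0_norm.
by move=> h; apply: filterS h => x /(_ I) /= -[s0] _; exact: f0.
Qed.

(** The mass of [zs] is one of the nonnegative terms adding up to the total weight of its mode pair
    at time [k]. *)
Lemma weight_modes_gt0 zs k : mass zs <> 0%E ->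
  0 < \sum_(l < MS k) w l (tnth zs (now k)) (tnth zs (Defs.next k)).
Proof.
move=> m_neq0; rewrite lt0r; apply/andP; split; last exact: sumr_ge0.
apply/eqP => w0; apply: m_neq0.
have := integral_smoothed_pair_cst th_param mix k (tnth zs (now k)) (tnth zs (Defs.next k)).
rewrite w0 (bigD1 zs) /= ?eqxx//; move/eqP; rewrite padde_eq0.
- by case/andP => /eqP.
- by apply: integral_ge0 => x _; rewrite lee_fin.
- by apply: sume_ge0 => zs' _; apply: integral_ge0 => x _; rewrite lee_fin.
Qed.

Lemma trans_prob_opt_gt0 zs k : mass zs <> 0%E ->
  0 < trans_prob theta_opt (tnth zs (Defs.next k)) (tnth zs (now k)).
Proof.
move=> /(@weight_modes_gt0 zs k) wk; rewrite trans_prob_opt divr_gt0//.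
rewrite (bigD1 k)//= ltr_pwDl//; apply: sumr_ge0 => k' _; exact: sumr_ge0.
Qed.

Lemma init_mixture_modes_gt0 zs x : mass zs <> 0%E -> 0 < q x (tnth zs ord0).
Proof.
move=> /(@weight_modes_gt0 zs k0); rewrite (now0 k00) => w0.
case: (pselect (exists l : 'I_(MS k0), 0 < w l (tnth zs ord0) (tnth zs (Defs.next k0)))).
  by move=> [l wl]; exact: (init_mixture_gt0 mix wl).
move=> nl; move: w0; rewrite big1 ?ltxx// => l _.
apply/eqP; rewrite eq_le w_ge0 andbT leNgt; apply/negP => wl.
by apply: nl; exists l.
Qed.

Let lf (th2 : @param R m nx nu ny) k (x : traj N.+1) (zs : modes) : R :=
  log_factor u y th2 k (tnth zs (now k)) (tnth x (now k), tnth x (Defs.next k)).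

Let I_lf th2 k zs : is_param th2 -> lebT.-integrable [set: traj N.+1]
  (EFin \o (fun x => lf th2 k x zs * s x zs)).
Proof.
case=> _ _ pd; apply: (integrable_smoothed_pair th_param mix).
  exact: measurable_log_factor.
by move=> l; exact: (integrable_log_factor mix).
Qed.

Let I_lnq zs : lebT.-integrable [set: traj N.+1]
  (EFin \o (fun x => ln (q (tnth x ord0) (tnth zs ord0)) * s x zs)).
Proof.
rewrite -(now0 k00).
apply: (integrable_smoothed_pair th_param mix
  (H := fun xx => ln (q xx.1 (tnth zs (now k0))))).
  apply: measurableT_comp; first exact: measurable_ln.
  apply: (measurableT_comp (measurable_init_mixture w mu P k0 (tnth zs (now k0)))).
  exact: measurable_fst.
by move=> l; exact: (integrable_ln_init_mixture mix).
Qed.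

Let I_cst zs c : lebT.-integrable [set: traj N.+1] (EFin \o (fun x => c * s x zs)).
Proof.
have := integrableZl measurableT c (Is zs).
by apply: eq_integrable => // x _ /=; rewrite EFinM.
Qed.

(** * Comparison with an arbitrary candidate *)

Section comparison.
Variable th2 : @param R m nx nu ny.
Hypothesis th2_param : is_param th2.

(** The density ratio of Gibbs' inequality for the initial term, taken against the mixture because
    [init_mixture_modes_gt0] holds at every [x]. *)
Let ratio (x : traj N.+1) (zs : modes) : R :=
  init_pdf th2 (tnth x ord0) (tnth zs ord0) / q (tnth x ord0) (tnth zs ord0).

Let measurable_ratio z : measurable_fun [set: state]
  (fun x => init_pdf th2 x z / q x z).
Proof.
case: th2_param => -[mi _ _] _ _; apply: measurable_funM; first exact: mi.
have mq := measurable_init_mixture w mu P k0 z.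
(* The reciprocal is written as [expR (- ln q)], a composition of measurable maps, and as 0 where
   [q] vanishes, in agreement with [0^-1 = 0]. *)
rewrite [X in measurable_fun _ X](_ : _ = fun x =>
    if 0 < q x z then expR (- ln (q x z)) else 0); last first.
  apply/funext => x; case: ltP => [q0|q_le0].
    by rewrite expRN lnK ?posrE.
  have -> : q x z = 0 by apply/le_anti; rewrite q_le0 (init_mixture_ge0 mix).
  by rewrite invr0.
apply: measurable_fun_ifT; first exact: measurable_fun_ltr.
  apply: measurableT_comp; first exact: measurable_expR.
  apply: measurableT_comp; first exact: oppr_measurable.
  by apply: measurableT_comp => //; exact: measurable_ln.
exact: measurable_cst.
Qed.

Let ratio_ge0 x zs : 0 <= ratio x zs.
Proof.
by case: th2_param => -[_ i0 _] _ _; rewrite divr_ge0// (init_mixture_ge0 mix).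
Qed.

(** Multiplying back by the mixture restores the candidate's initial density, of total mass 1. There
    may be a loss where the mixture vanishes, hence an inequality. *)
Let sum_ratio :
  (\sum_(zs : modes) \int[lebT]_x (ratio x zs * s x zs)%:E <= 1)%E.
Proof.
case: (th2_param) => -[mi i0 i1] _ _.
rewrite (partition_big (fun zs : modes => tnth zs ord0) xpredT)//= -[leRHS]i1.
apply: lee_sum => z _.
have -> : (\sum_(zs : modes | tnth zs ord0 == z)
    \int[lebT]_x (ratio x zs * s x zs)%:E =
    \int[leb nx]_x ((init_pdf th2 x z / q x z)%:E * (q x z)%:E))%E.
  rewrite -(integral_smoothed_init th_param mix k00).
  - apply: eq_bigr => zs /eqP zsz; apply: eq_integral => x _.
    by rewrite /ratio zsz EFinM.
  - exact/measurable_EFinP.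
  - by move=> x; rewrite lee_fin divr_ge0// (init_mixture_ge0 mix).
apply: ge0_le_integral => //.
- by move=> x _; rewrite mule_ge0 ?lee_fin ?divr_ge0 ?(init_mixture_ge0 mix).
- apply: emeasurable_funM; first exact/measurable_EFinP.
  by apply/measurable_EFinP; exact: measurable_init_mixture.
- exact/measurable_EFinP.
move=> x _; rewrite -EFinM lee_fin.
by have [->|q0] := eqVneq (q x z) 0; [rewrite mulr0|rewrite divfK].
Qed.

Let I_ratio zs : lebT.-integrable [set: traj N.+1]
  (EFin \o (fun x => ratio x zs * s x zs)).
Proof.
apply/integrableP; split.
  apply/measurable_EFinP; apply: measurable_funM => //.
  apply: (measurableT_comp (measurable_ratio (tnth zs ord0))).
  exact: measurable_tnth.
under eq_integral do rewrite /= (ger0_norm (mulr_ge0 (ratio_ge0 _ _) (s_ge0 _ _))).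
apply: le_lt_trans (ltry 1); apply: le_trans sum_ratio.
rewrite (bigD1 zs)//= leeDl//; apply: sume_ge0 => zs' _.
by apply: integral_ge0 => x _; rewrite lee_fin (mulr_ge0 (ratio_ge0 _ _) (s_ge0 _ _)).
Qed.

Let tau (z z' : 'I_m) : R := trans_prob th2 z' z / trans_prob theta_opt z' z - 1.

(** By [trans_prob_opt] the total weight of a transition is [cm w z] times its optimal probability,
    so for each [z] the sum is at most [cm w z] times a difference of column sums: at most 1 for the
    candidate, exactly 1 for the optimum. *)
Let sum_tau : \sum_(k < N) \sum_(zs : modes)
  \int[lebT]_x (tau (tnth zs (now k)) (tnth zs (Defs.next k)) * s x zs) <= 0.
Proof.
under eq_bigr do rewrite (sum_cst th_param mix).
rewrite exchange_big; apply: sumr_le0 => z _ /=.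
rewrite exchange_big /=.
under eq_bigr do rewrite -mulr_suml.
have cmz := cm_gt0 z; have cm_neq0 : cm w z != 0 by rewrite gt_eqF.
have t0 z' : 0 <= trans_prob th2 z' z by exact: trans_prob_ge0.
apply: (@le_trans _ _ (\sum_(z' < m)
    cm w z * (trans_prob th2 z' z - trans_prob theta_opt z' z))).
  apply: ler_sum => z' _.
  have -> : \sum_(k < N) \sum_(l < MS k) w l z z' =
      cm w z * trans_prob theta_opt z' z.
    by rewrite trans_prob_opt mulrC divfK.
  rewrite -mulrA ler_wpM2l ?(ltW cmz)// /tau mulrBr mulr1 lerB//.
  (* A transition of optimal probability 0 has weight 0, so its term contributes 0, at most the
     candidate's probability. *)
  have [->|t_neq0] := eqVneq (trans_prob theta_opt z' z) 0.
    by rewrite mul0r.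
  by rewrite mulrC divfK.
rewrite -mulr_sumr pmulr_rle0// sumrB subr_le0.
have -> : \sum_(z' < m) trans_prob theta_opt z' z = 1.
  under eq_bigr do rewrite trans_prob_opt.
  by rewrite -mulr_suml exchange_big /= -/(cm w z) mulfV.
rewrite /trans_prob -mulr_suml.
(* A zero column of the candidate gives probabilities summing to 0, still at most 1. *)
have [->|S0] := eqVneq (\sum_(l < m) Tmat th2 l z) 0; first by rewrite mul0r.
by rewrite mulfV.
Qed.

Let sum_lf : \sum_(k < N) \sum_(zs : modes) \int[lebT]_x (lf th2 k x zs * s x zs) <=
  \sum_(k < N) \sum_(zs : modes) \int[lebT]_x (lf theta_opt k x zs * s x zs).
Proof.
have pd2 z : pos_def (Pi th2 z) by case: th2_param.
have pdo z : pos_def (Pi theta_opt z) by exact: Pi_pd.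
have lfE (th3 : @param R m nx nu ny) (pd3 : forall z, pos_def (Pi th3 z)) :
    \sum_(k < N) \sum_(zs : modes) \int[lebT]_x (lf th3 k x zs * s x zs) =
    \sum_(z < m) - ((cm w z * log_const th3 z +
      \tr (log_form th3 z *m Mmx u y w mu P z)) / 2).
  exact: (sum_log_factor th_param mix pd3).
rewrite [leLHS](lfE _ pd2) [leRHS](lfE _ pdo).
apply: ler_sum => z _; rewrite lerN2 ler_pM2r ?invr_gt0//.
(* Cyclicity of the trace gathers the residual matrices around the moment matrix, and [Mh_sqrt]
   replaces the latter by [Mh^T *m Mh]. *)
have trE (th3 : @param R m nx nu ny) :
    \tr (log_form th3 z *m Mmx u y w mu P z) =
    \tr (invmx (Pi th3 z) *m residual_moment (Mh z) (Gam th3 z)).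
  rewrite /log_form /residual_moment (Mh_sqrt z).
  by rewrite -!mulmxA mxtrace_mulC !mulmxA.
have lcE (th3 : @param R m nx nu ny) : pos_def (Pi th3 z) ->
    log_const th3 z = ln ((2 * pi) ^+ (ny + nx)) + ln (\det (Pi th3 z)).
  move=> pd; rewrite /log_const lnM ?posrE ?det_pos_def// exprn_gt0// mulr_gt0//.
  exact: pi_gt0.
rewrite !trE !lcE// !mulrDr -!addrA lerD2l.
exact: (Gam_opt_Pi_half_min (Gam th2 z) (cm_gt0 z) (Sigma_unit z) (Pi_pd z) (pd2 z)).
Qed.

(** On sequences of nonzero mass this is the log-density of [theta_opt], with the mixture in place
    of the smoothed initial density. *)
Let Hs (x : traj N.+1) (zs : modes) : R := ln (q (tnth x ord0) (tnth zs ord0)) +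
  \sum_(k < N) (lf theta_opt k x zs +
    ln (trans_prob theta_opt (tnth zs (Defs.next k)) (tnth zs (now k)))).

(** Allowance for passing from [theta_opt] to [th2]: the exact difference in the Gaussian terms, and
    [r - 1] in place of [ln r] in the initial and transition terms, which keeps it integrable. *)
Let Ds (x : traj N.+1) (zs : modes) : R := (ratio x zs - 1) +
  \sum_(k < N) ((lf th2 k x zs - lf theta_opt k x zs) +
    tau (tnth zs (now k)) (tnth zs (Defs.next k))).

Let I_H zs : lebT.-integrable [set: traj N.+1] (EFin \o (fun x => Hs x zs * s x zs)).
Proof.
have Ik k : lebT.-integrable [set: traj N.+1] (EFin \o (fun x =>
    lf theta_opt k x zs * s x zs +
    ln (trans_prob theta_opt (tnth zs (Defs.next k)) (tnth zs (now k))) * s x zs)).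
  have := integrableD measurableT (I_lf k zs theta_opt_is_param) (I_cst zs
    (ln (trans_prob theta_opt (tnth zs (Defs.next k)) (tnth zs (now k))))).
  by apply: eq_integrable => // x _ /=; rewrite EFinD.
have := integrableD measurableT (I_lnq zs) (integrable_sumr (index_enum _) Ik).
apply: eq_integrable => // x _ /=; rewrite -EFinD mulrDl mulr_suml.
by congr (EFin (_ + _)); apply: eq_bigr => k _; rewrite mulrDl.
Qed.

Let I_D zs : lebT.-integrable [set: traj N.+1] (EFin \o (fun x => Ds x zs * s x zs)) /\
  \int[lebT]_x (Ds x zs * s x zs) =
  (\int[lebT]_x (ratio x zs * s x zs) - \int[lebT]_x s x zs) +
  \sum_(k < N) ((\int[lebT]_x (lf th2 k x zs * s x zs) -
    \int[lebT]_x (lf theta_opt k x zs * s x zs)) +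
    \int[lebT]_x (tau (tnth zs (now k)) (tnth zs (Defs.next k)) * s x zs)).
Proof.
have I1 : lebT.-integrable [set: traj N.+1]
    (EFin \o (fun x => ratio x zs * s x zs - s x zs)).
  have := integrableB measurableT (I_ratio zs) (Is zs).
  by apply: eq_integrable => // x _ /=; rewrite EFinB.
have I2 k : lebT.-integrable [set: traj N.+1]
    (EFin \o (fun x => lf th2 k x zs * s x zs - lf theta_opt k x zs * s x zs)).
  have := integrableB measurableT (I_lf k zs th2_param) (I_lf k zs theta_opt_is_param).
  by apply: eq_integrable => // x _ /=; rewrite EFinB.
have I3 k : lebT.-integrable [set: traj N.+1] (EFin \o (fun x =>
    (lf th2 k x zs * s x zs - lf theta_opt k x zs * s x zs) +
    tau (tnth zs (now k)) (tnth zs (Defs.next k)) * s x zs)).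
  have := integrableD measurableT (I2 k)
    (I_cst zs (tau (tnth zs (now k)) (tnth zs (Defs.next k)))).
  by apply: eq_integrable => // x _ /=; rewrite EFinD.
have I4 := integrable_sumr (index_enum 'I_N) I3.
have DE x : Ds x zs * s x zs = (ratio x zs * s x zs - s x zs) + \sum_(k < N)
    ((lf th2 k x zs * s x zs - lf theta_opt k x zs * s x zs) +
    tau (tnth zs (now k)) (tnth zs (Defs.next k)) * s x zs).
  rewrite /Ds mulrDl mulrBl mul1r mulr_suml; congr (_ + _).
  by apply: eq_bigr => k _; rewrite mulrDl mulrBl.
split.
  have := integrableD measurableT I1 I4.
  by apply: eq_integrable => // x _ /=; rewrite DE EFinD.
under eq_Rintegral do rewrite DE.
rewrite RintegralD// RintegralB// Rintegral_sum//; congr (_ + _).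
apply: eq_bigr => k _; rewrite (RintegralD measurableT (I2 k) (I_cst zs _)).
by rewrite (RintegralB measurableT (I_lf k zs th2_param) (I_lf k zs theta_opt_is_param)).
Qed.

Let sum_D : \sum_(zs : modes) \int[lebT]_x (Ds x zs * s x zs) <= 0.
Proof.
under eq_bigr do rewrite (I_D _).2.
rewrite big_split /= sumrB exchange_big /=.
under [X in _ + X]eq_bigr do rewrite big_split /= sumrB.
rewrite big_split /= sumrB.
have s1 : \sum_(zs : modes) \int[lebT]_x s x zs = 1.
  apply: EFin_inj; rewrite -sumEFin -[RHS](sum_integral_smoothed_pdf th_param evid).
  by apply: eq_bigr => zs _; rewrite Rintegral_EFin.
have r1 : \sum_(zs : modes) \int[lebT]_x (ratio x zs * s x zs) <= 1.
  rewrite -lee_fin -sumEFin; apply: le_trans sum_ratio.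
  by apply: lee_sum => zs _; rewrite Rintegral_EFin.
have le0 (a b c e : R) : a <= 1 -> b <= c -> e <= 0 -> a - 1 + (b - c + e) <= 0.
  by lra.
by rewrite s1; exact: (le0 _ _ _ _ r1 sum_lf sum_tau).
Qed.

Let measurable_lne_joint th3 zs : is_param th3 -> measurable_fun [set: traj N.+1]
  (fun x => lne (joint_pdf u y th3 x zs)%:E * (s x zs)%:E)%E.
Proof.
move=> p3; apply: emeasurable_funM; last exact/measurable_EFinP.
by apply: measurable_lne; exact: measurable_joint_pdf.
Qed.

(** Both sides are 0 on a sequence of zero mass. Otherwise the integrands compare pointwise: where
    [s] vanishes both are 0, where the candidate's density vanishes the left one is [-oo], and
    elsewhere [ln r <= r - 1] applies term by term. *)
Let upper zs : (\int[lebT]_x (lne (joint_pdf u y th2 x zs)%:E * (s x zs)%:E) <=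
  \int[lebT]_x (Hs x zs * s x zs + Ds x zs * s x zs)%:E)%E.
Proof.
have I_HD : lebT.-integrable [set: traj N.+1]
    (EFin \o (fun x => Hs x zs * s x zs + Ds x zs * s x zs)).
  have := integrableD measurableT (I_H zs) (I_D zs).1.
  by apply: eq_integrable => // x _ /=; rewrite EFinD.
case: (pselect (mass zs = 0%E)) => [m0|m_neq0].
  rewrite [leLHS](null_modes m0 (measurable_lne_joint zs th2_param)); last first.
    by move=> x ->; rewrite mule0.
  rewrite [leRHS](null_modes m0 (measurable_int _ I_HD))// => x s0 /=.
  by rewrite s0 !mulr0 addr0.
apply: le_integral_integrable => //; first exact: measurable_lne_joint.
move=> x; have := s_ge0 x zs; rewrite le_eqVlt => /predU1P[<-|s0].
  by rewrite !mulr0 addr0 mule0.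
have := joint_pdf_ge0 u y th2_param x zs; rewrite le_eqVlt => /predU1P[<-|j0].
  by rewrite le0_lneNy// gt0_mulNye ?lte_fin// leNye.
have [i0 t0] := joint_pdf_gt0 th2_param j0.
rewrite ln_joint_pdf// -mulrDl -EFinM lee_fin ler_pM2r//.
have q0 := init_mixture_modes_gt0 (tnth x ord0) m_neq0.
have ln_le : ln (init_pdf th2 (tnth x ord0) (tnth zs ord0)) <=
    ln (q (tnth x ord0) (tnth zs ord0)) + (ratio x zs - 1).
  rewrite -lerBlDl -ln_div ?posrE//; apply: ln_le_subr1.
  by rewrite divr_gt0.
rewrite /Hs /Ds addrACA; apply: lerD => //; rewrite -big_split /=.
apply: ler_sum => k _; have to := trans_prob_opt_gt0 k m_neq0.
have := @ln_le_subr1 R (trans_prob th2 (tnth zs (Defs.next k)) (tnth zs (now k)) /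
  trans_prob theta_opt (tnth zs (Defs.next k)) (tnth zs (now k))).
rewrite divr_gt0// => /(_ isT); rewrite ln_div ?posrE//.
have aux (g2 go t2 t1 t12 : R) : t2 - t1 <= t12 ->
    g2 + t2 <= go + t1 + (g2 - go + t12) by lra.
exact: (aux (lf th2 k x zs)).
Qed.

(** The log-density of [theta_opt] equals [Hs] wherever the smoothed initial density equals the
    mixture, and [ae_tuple_head] lifts this almost everywhere statement from the first state to
    trajectories. *)
Let exact_opt zs : (\int[lebT]_x
    (lne (joint_pdf u y theta_opt x zs)%:E * (s x zs)%:E) =
  \int[lebT]_x (Hs x zs * s x zs)%:E)%E.
Proof.
have mH := measurable_int _ (I_H zs).
have ml := measurable_lne_joint zs theta_opt_is_param.
case: (pselect (mass zs = 0%E)) => [m0|m_neq0].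
  rewrite [LHS](null_modes m0 ml); last by move=> x ->; rewrite mule0.
  by rewrite [RHS](null_modes m0 mH)// => x s0 /=; rewrite s0 mulr0.
apply: ae_eq_integral => //.
have := ae_tuple_head N (smoothed_init_pdf_mixture th_param mix k00 (tnth zs ord0)).
apply: filterS => x pq _.
have q0 := init_mixture_modes_gt0 (tnth x ord0) m_neq0.
rewrite ln_joint_pdf.
- by rewrite /= pq -EFinM.
- exact: theta_opt_is_param.
- by rewrite /= pq.
- by move=> k; exact: trans_prob_opt_gt0.
Qed.

Lemma Qfun_le_theta_opt : (Qfun u y th2 th <= Qfun u y theta_opt th)%E.
Proof.
rewrite /Qfun [leRHS](eq_bigr _ (fun zs _ => exact_opt zs)).
apply: (@le_trans _ _ (\sum_(zs : modes)
    \int[lebT]_x (Hs x zs * s x zs + Ds x zs * s x zs)%:E)%E).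
  by apply: lee_sum => zs _; exact: upper.
(* Both parts are integrable, so the comparison becomes one between real numbers and the common [Hs]
   part cancels. *)
have HDE zs : (\int[lebT]_x (Hs x zs * s x zs + Ds x zs * s x zs)%:E =
    (\int[lebT]_x (Hs x zs * s x zs) + \int[lebT]_x (Ds x zs * s x zs))%:E)%E.
  rewrite EFinD !Rintegral_EFin//; last exact: (I_D zs).1.
  by rewrite -integralD_EFin//; exact: (I_D zs).1.
rewrite [leLHS](eq_bigr _ (fun zs _ => HDE zs)).
rewrite [leRHS](eq_bigr _ (fun zs _ => esym (Rintegral_EFin (I_H zs)))).
rewrite !sumEFin lee_fin big_split /= gerDl.
exact: sum_D.
Qed.

End comparison.
End optimum.

Theorem lemma3p5 (R : realType) (m nx nu ny N : nat)
    (u : 'I_N -> 'cV[R]_nu) (y : 'I_N -> 'cV[R]_ny)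
    (th' : @param R m nx nu ny)
    (MS : 'I_N -> nat)
    (w : forall k : 'I_N, 'I_(MS k) -> 'I_m -> 'I_m -> R)
    (mu : forall k : 'I_N, 'I_(MS k) -> 'I_m -> 'I_m -> 'cV[R]_(nx + nx))
    (P : forall k : 'I_N, 'I_(MS k) -> 'I_m -> 'I_m -> 'M[R]_(nx + nx))
    (r : 'I_m -> nat)
    (Mh : forall z : 'I_m, 'M[R]_(r z, nx + (nx + (nu + ny)))) :
  is_param th' ->
  is_smoothed_mixture u y w mu P th' ->
  (forall z, is_sqrt_factor (Mh z) (Mmx u y w mu P z)) ->
  (forall z, 0 < cm w z) ->
  (forall z, Sigma (Mh z) \in unitmx) ->
  (forall z, let Ph := Pi_half (Mh z) (cm w z) (Gam_opt (Mh z)) in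
     pos_def (Ph^T *m Ph)) ->
  (exists th : @param R m nx nu ny,
    [/\ (forall x z, init_pdf th x z = smoothed_init_pdf u y th' x z),
        (forall z, Gam th z = Psi (Mh z) *m invmx (Sigma (Mh z))),
        (forall z' z, Tmat th z' z =
           (\sum_(k < N) \sum_(j < MS k) w k j z z') / cm w z) &
        (forall z, let Ph := Pi_half (Mh z) (cm w z) (Gam th z) in
           [/\ is_sqrt_factor Ph (Pi th z),
               exists O, is_qless_QR O Ph &
               forall O, is_qless_QR O Ph ->
                 is_sqrt_factor (O *m Ph) (Pi th z)])]
    /\ is_param th
    /\ (forall th2 : @param R m nx nu ny, is_param th2 ->
          (Qfun u y th2 th' <= Qfun u y th th')%E))
  /\
  (forall (n p : nat) (q : 'I_p -> nat) (a : 'I_p -> R)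
          (A : forall i : 'I_p, 'M[R]_(q i, n)),
    (forall i, 0 <= a i) ->
    let X := \mxcol_(i < p) (Num.sqrt (a i) *: A i) in
    (exists O, is_qless_QR O X) /\
    (forall O, is_qless_QR O X ->
       is_sqrt_factor (O *m X) (\sum_(i < p) a i *: ((A i)^T *m A i)))).
Proof.
move=> th_param mix Mh_sqrt cm0 Su Ppd; split; last first.
  move=> n p q a A a0 X; split; first exact: qless_QR_exists.
  by move=> O /qless_QR_sqrt_factor; rewrite [X^T *m X]mxcol_sqrt_factor.
have [z0 _] := param_mode th_param.
(* For [N = 0] the sum [cm w z0] would be empty, hence not positive. A first time step is what [k0]
   needs. *)
have N0 : (0 < N)%N.
  rewrite lt0n; apply/negP => /eqP N0; have := cm0 z0.
  by rewrite /cm big1 ?ltxx// => k; have := ltn_ord k; rewrite {2}N0.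
pose k0 := Ordinal N0; have k00 : k0 = 0 :> nat by [].
exists (theta_opt u y th' w Mh); split; [split|split] => //.
- by move=> z' z; rewrite mxE.
- move=> z Ph; split => //; first exact: qless_QR_exists.
  by move=> O; exact: qless_QR_sqrt_factor.
- exact: (theta_opt_is_param th_param mix cm0 Ppd k00).
- move=> th2 th2_param.
  exact: (Qfun_le_theta_opt th_param mix Mh_sqrt cm0 Su Ppd k00 th2_param).
Qed.
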